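(* There is a well-defined surjective homomorphism $T_\tau\to\mathbb Z/2\mathbb Z$ sending every $x_n$ ($n\ge 0$) and every $c_n$ ($n\ge1$) to $0$ and every $y_n$ ($n\ge0$) to $1$. Likewise, there is a well-defined surjective homomorphism $V_\tau\to\mathbb Z/2\mathbb Z$ sending every $x_n$ ($n\ge0$), $c_n$ ($n\ge 1$) and $\pi_n$ ($n\ge0$) to $0$ and every $y_n$ ($n\ge0$) to $1$. In particular, each of $T_\tau$ and $V_\tau$ has a normal subgroup of index $2$.
   Context: Let $\tau=(\sqrt5-1)/2$, so $1=\tau+\tau^2$. $V_\tau$ is the group (under composition, $fg=f\circ g$) of left-continuous piecewise-linear bijections of $(0,1]$ with finitely many breakpoints (including discontinuities), all in $\mathbb Z[\tau]$, and all slopes integer powers of $\tau$. $T_\tau$ is the subgroup of those elements of $V_\tau$ which induce orientation-preserving homeomorphisms of the circle obtained from $[0,1]$ by identifying $0$ and $1$. Trees. An $x$-caret subdivides an interval $(a,a+L]$ into $(a,a+\tau^2L]$ and $(a+\tau^2L,a+L]$; a $y$-caret subdivides it into $(a,a+\tau L]$ and $(a+\tau L,a+L]$. A tree is a finite rooted binary tree whose interior nodes (carets) are each of type $x$ or $y$; with root $(0,1]$, its leaves, ordered from left to right, give a subdivision of $(0,1]$. A triple $(T_1,\pi,T_2)$, with $T_1,T_2$ trees with $k$ leaves and $\pi$ a permutation of the $k$ leaf positions, represents the element of $V_\tau$ mapping the interval of leaf $i$ of $T_2$ affinely and increasingly onto the interval of leaf $\pi(i)$ of $T_1$. Generators. The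 spine $S_m$ is the tree with $m$ $x$-carets, each one after the first attached to the right leg of the previous one; its leaves are numbered $0,1,\dots,m$ from left to right. For $n\ge0$, $x_n$ (resp. $y_n$) is the element $(T,\mathrm{id},S_{n+2})$, where $T$ is obtained from $S_{n+1}$ by attaching an $x$-caret (resp. a $y$-caret) to its leaf number $n$. For $n\ge1$, $c_n=(S_{n+1},\gamma,S_{n+1})$, where $\gamma$ is the cyclic permutation sending leaf $0$ to leaf $n+1$ and leaf $i$ to leaf $i-1$ for $1\le i\le n+1$. For $n\ge 0$, $\pi_n=(S_{n+2},\sigma,S_{n+2})$, where $\sigma$ is the transposition exchanging leaves $n$ and $n+1$. The elements $x_n,y_n,c_n$ generate $T_\tau$, and the elements $x_n,y_n,c_n,\pi_n$ generate $V_\tau$. *)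

(* Defs.v *)
From HB Require Import structures.
From mathcomp Require Import all_boot all_order all_algebra all_fingroup.
From mathcomp Require Import ring lra.
From mathcomp Require Import all_classical all_reals all_analysis.
Import Order.TTheory GRing.Theory Num.Theory numFieldNormedType.Exports.

Set Implicit Arguments.
Unset Strict Implicit.
Unset Printing Implicit Defensive.

Local Open Scope classical_set_scope.
Local Open Scope ring_scope.

Section Vtau.
Variable R : realType.
Implicit Types (f g : R -> R) (x a b : R) (s : seq R).

Definition tau : R := (Num.sqrt 5 - 1) / 2.

Definition Ztau : set R := [set x | exists m n : int, x = m%:~R + n%:~R * tau].

(* A self-map of (0,1] is encoded as the map R -> R that extends it by the
   identity, so that equality of functions is equality of the self-maps.
   The breakpoints are listed (with possible superfluous points) by s: f is
   affine, with slope a power of tau, on each open subinterval of (0,1] that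
   contains no point of s. *)
Definition is_Vtau f : Prop :=
  [/\ set_bij `]0, 1] `]0, 1] f,
      (forall x, ~ `]0, 1]%classic x -> f x = x),
      (forall x, `]0, 1]%classic x -> f y @[y --> x^'-] --> f x)
    & exists s : seq R, (forall p, p \in s -> Ztau p) /\
        forall a b, a < b -> `]a, b[ `<=` `]0, 1] ->
          (forall p, p \in s -> ~ `]a, b[%classic p) ->
          exists (k : int) (c : R), forall x, `]a, b[%classic x ->
            f x = tau ^ k * x + c].

Lemma tau_eq : 1 = tau + tau ^+ 2.
Proof.
have h : Num.sqrt 5 ^+ 2 = 5 :> R by rewrite sqr_sqrtr.
rewrite /tau; have := h; set q := Num.sqrt 5 => hq.
have -> : (q - 1) / 2 + ((q - 1) / 2) ^+ 2 = (q ^+ 2 - 1) / 4 by field.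
by rewrite hq; lra.
Qed.

Lemma tau_gt0 : 0 < tau.
Proof.
rewrite divr_gt0 // subr_gt0 -[ltLHS]sqrtr1 ltr_sqrt //; lra.
Qed.

Lemma tauX_gt0 (k : int) : 0 < tau ^ k.
Proof. by rewrite exprz_gt0 // tau_gt0. Qed.

Lemma Ztau0 : Ztau 0.
Proof. by exists 0, 0; rewrite mul0r addr0. Qed.

Lemma Ztau1 : Ztau 1.
Proof. by exists 1, 0; rewrite mul0r addr0. Qed.

Lemma ZtauD x y : Ztau x -> Ztau y -> Ztau (x + y).
Proof.
move=> [m [n ->]] [p [q ->]]; exists (m + p), (n + q).
by rewrite !rmorphD /=; ring.
Qed.

Lemma ZtauN x : Ztau x -> Ztau (- x).
Proof.
move=> [m [n ->]]; exists (- m), (- n).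
by rewrite !rmorphN /=; ring.
Qed.

Lemma ZtauB x y : Ztau x -> Ztau y -> Ztau (x - y).
Proof. by move=> hx hy; apply: ZtauD => //; exact: ZtauN. Qed.

Lemma Ztau_tau : Ztau tau.
Proof. by exists 0, 1; rewrite add0r mul1r. Qed.

Lemma ZtauM x y : Ztau x -> Ztau y -> Ztau (x * y).
Proof.
move=> [m [n ->]] [p [q ->]]; exists (m * p + n * q), (m * q + n * p - n * q).
have h : tau ^+ 2 = 1 - tau by have := tau_eq; lra.
rewrite !(rmorphD, rmorphB, rmorphM) /=.
set M := m%:~R; set N := n%:~R; set P := p%:~R; set Q := q%:~R.
have -> : (M + N * tau) * (P + Q * tau)
  = M * P + (M * Q + N * P) * tau + N * Q * tau ^+ 2 by ring.
rewrite h; ring.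
Qed.

Lemma Ztau_tauV : Ztau tau^-1.
Proof.
exists 1, 1; have h := tau_eq; have t0 := tau_gt0.
have tn : tau != 0 by rewrite gt_eqF.
apply: (mulfI tn); rewrite mulfV // [LHS]h; ring.
Qed.

Lemma ZtauX (k : int) : Ztau (tau ^ k).
Proof.
have hX (z : R) (n : nat) : Ztau z -> Ztau (z ^+ n).
  by move=> hz; elim: n => [|n ih]; [exact: Ztau1|rewrite exprS; exact: ZtauM].
case: k => n; first by apply: hX; exact: Ztau_tau.
by rewrite NegzE -exprz_inv; apply: (hX _ n.+1); exact: Ztau_tauV.
Qed.

(* The affinity condition of is_Vtau on half-open intervals, which is what it
   becomes once f is known to be left-continuous. *)
Definition affine_off f s := forall a b, 0 <= a -> a < b -> b <= 1 ->
  (forall p, p \in s -> ~~ (a < p < b)) ->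
  exists (k : int) (c : R), forall x, a < x <= b -> f x = tau ^ k * x + c.

(* f and g are inverse bijections of (0,1], extended by the identity. *)
Definition bij01 f g := [/\ cancel f g, cancel g f,
  (forall x, (0 < f x <= 1) = (0 < x <= 1)) &
  (forall x, ~~ (0 < x <= 1) -> f x = x)].

Lemma in01 x : `]0, 1]%classic x = (0 < x <= 1).
Proof. by rewrite /= in_itv. Qed.

Lemma bij01P f : set_bij `]0, 1] `]0, 1] f ->
  (forall x, ~ `]0, 1]%classic x -> f x = x) -> exists g, bij01 f g.
Proof.
move=> [hf hi hs] ho.
have ho' x : ~~ (0 < x <= 1) -> f x = x.
  by move=> hx; apply: ho; rewrite in01; exact/negP.
have hf' x : (0 < f x <= 1) = (0 < x <= 1).
  have [hx|hx] := boolP (0 < x <= 1); last by rewrite ho' // (negbTE hx).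
  by have := hf x; rewrite !in01 => /(_ hx).
have hinj : injective f.
  move=> x y e.
  have [hx|hx] := boolP (0 < x <= 1).
    have hy : 0 < y <= 1 by rewrite -hf' -e hf'.
    by apply: hi => //; rewrite inE in01.
  have hy : ~~ (0 < y <= 1) by rewrite -hf' -e hf'.
  by rewrite -(ho' _ hx) -(ho' _ hy).
have hsurj y : exists x, f x = y.
  have [hy|hy] := boolP (0 < y <= 1); last by exists y; exact: ho'.
  have := hs y; rewrite in01 => /(_ hy) [x _ <-]; by exists x.
have [g hg] := choice hsurj.
exists g; split=> //.
by move=> x; apply: hinj; rewrite hg.
Qed.

Lemma bij01_set_bij f g : bij01 f g -> set_bij `]0, 1] `]0, 1] f.
Proof.
move=> [fg gf h1 h2]; split.
- by move=> x; rewrite !in01 h1.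
- by move=> x y _ _; exact: (can_inj fg).
- by move=> y; rewrite in01 => hy; exists (g y) => //; rewrite in01 -h1 gf.
Qed.

Lemma bij01_sym f g : bij01 f g -> bij01 g f.
Proof.
move=> [fg gf h1 h2]; split=> // x; first by rewrite -h1 gf.
by move=> hx; rewrite -[in LHS](h2 x hx) fg.
Qed.

Lemma bij01_comp f g f' g' : bij01 f g -> bij01 f' g' ->
  bij01 (f \o f') (g' \o g).
Proof.
move=> [fg gf h1 h2] [fg' gf' h1' h2']; split.
- by move=> x /=; rewrite fg fg'.
- by move=> x /=; rewrite gf' gf.
- by move=> x /=; rewrite h1 h1'.
- by move=> x hx /=; rewrite h2 h2'.
Qed.

Lemma aff_cvg (k : int) (c x : R) :
  tau ^ k * y + c @[y --> x^'-] --> tau ^ k * x + c.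
Proof.
apply: cvg_at_left_filter; apply: cvgD; last exact: cvg_cst.
by apply: cvgM; [exact: cvg_cst|exact: cvg_id].
Qed.

Lemma affP f : is_Vtau f -> exists s, (forall p, p \in s -> Ztau p) /\ affine_off f s.
Proof.
move=> [_ _ hl [s [hs ha]]]; exists s; split=> // a b a0 ab b1 hp.
have [||k [c hk]] := ha a b ab.
- by move=> x /=; rewrite !in_itv /= => /andP[h1 h2]; apply/andP; split; lra.
- by move=> p ps /=; rewrite in_itv /=; apply/negP; exact: hp.
exists k, c => x /andP[ax]; rewrite le_eqVlt => /predU1P[->|xb]; last first.
  by apply: hk; rewrite /= in_itv /= ax.
have hb : `]0, 1]%classic b by rewrite in01; apply/andP; split; lra.
apply: (@cvg_unique _ _ (f y @[y --> b^'-])) => //; first exact: hl.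
apply: cvg_trans (@aff_cvg k c b); apply: near_eq_cvg.
near=> y; apply/esym/hk; rewrite /= in_itv /=; apply/andP; split; near: y.
- exact: nbhs_left_gt.
- exact: nbhs_left_lt.
Unshelve. all: by end_near.
Qed.

Lemma prevP s b : 0 < b -> exists p, [/\ p \in 0 :: s, 0 <= p, p < b
  & forall q, q \in s -> ~~ (p < q < b)].
Proof.
move=> b0; elim: s => [|q s [p [ps p0 pb hp]]].
  by exists 0; rewrite mem_head.
have [hq|hq] := boolP (p < q < b).
  exists q; move/andP: hq => [pq qb].
  rewrite !inE eqxx orbT; split=> //; first lra.
  move=> r; rewrite inE => /predU1P[->|rs]; first by rewrite ltxx.
  apply: contra (hp r rs) => /andP[h1 h2]; apply/andP; split; lra.
exists p; split=> //.
  by move: ps; rewrite !inE => /orP[->//|->]; rewrite !orbT.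
by move=> r; rewrite inE => /predU1P[->|/hp].
Qed.

Lemma nextP s a : a < 1 -> exists p, [/\ a < p, p <= 1
  & forall q, q \in s -> ~~ (a < q < p)].
Proof.
move=> a1; elim: s => [|q s [p [ap p1 hp]]]; first by exists 1.
have [/andP[aq qp]|hq] := boolP (a < q < p).
  exists q; split=> //; first lra.
  move=> r; rewrite inE => /predU1P[->|rs]; first by rewrite ltxx andbF.
  apply: contra (hp r rs) => /andP[h1 h2]; apply/andP; split; lra.
by exists p; split=> // r; rewrite inE => /predU1P[->|/hp].
Qed.

Lemma mid x b : x < b -> exists2 y, x < y & y < b.
Proof. by move=> h; exists ((x + b) / 2); lra. Qed.

Lemma left_end_ge0 (k : int) (c p b : R) : p < b ->
  (forall x, p < x <= b -> 0 < tau ^ k * x + c) -> 0 <= tau ^ k * p + c.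
Proof.
move=> pb h; rewrite leNgt; apply/negP; set l := tau ^ k * p + c => ln.
have tk := tauX_gt0 k.
set x := Num.min b (p - l / tau ^ k).
have px : p < x.
  by rewrite lt_min pb /= ltrBrDl gtrDr pmulr_llt0 // invr_gt0.
have xb : x <= b by rewrite ge_min lexx.
have := h x; rewrite px xb => /(_ isT).
have : tau ^ k * x <= tau ^ k * (p - l / tau ^ k).
  by rewrite ler_pM2l // ge_min lexx orbT.
have e : tau ^ k * (l / tau ^ k) = l by rewrite mulrC divfK ?gt_eqF.
by rewrite mulrBr e /l; lra.
Qed.

(* The image of a maximal half-open interval of affinity starts at 0 or at the
   image of a breakpoint. *)
Lemma pieceP f g s : bij01 f g -> affine_off f s -> forall b, 0 < b <= 1 ->
  exists (p : R) (k : int) (c : R), [/\ p \in 0 :: s, 0 <= p < b,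
    (forall x, p < x <= b -> f x = tau ^ k * x + c),
    0 <= tau ^ k * p + c
    & tau ^ k * p + c = 0 \/ exists2 q, (q \in 1 :: s) && (0 < q <= 1)
                                     & f q = tau ^ k * p + c].
Proof.
move=> [fg gf hI _] haf b /andP[b0 b1].
have [p [ps p0 pb hp]] := prevP s b0.
have [k [c hk]] := haf p b p0 pb b1 hp.
have tk := tauX_gt0 k.
have l0' : 0 <= tau ^ k * p + c.
  apply: (left_end_ge0 pb) => x /[dup] hx /hk <-.
  have : 0 < f x <= 1 by rewrite hI; case/andP: hx => *; apply/andP; split; lra.
  by case/andP.
exists p, k, c; rewrite p0 pb; split=> //.
have [->|l0] := eqVneq (tau ^ k * p + c) 0; [by left|right].
set l := tau ^ k * p + c in l0 l0' *.
have lI : 0 < l <= 1.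
  rewrite lt_neqAle eq_sym l0 l0' /=.
  have : 0 < f b <= 1 by rewrite hI b0.
  rewrite (hk b) ?pb ?lexx // => /andP[_]; apply: le_trans.
  by rewrite /l lerD2r ler_pM2l // ltW.
set q := g l.
have fq : f q = l by rewrite /q gf.
have qI : 0 < q <= 1 by rewrite -hI fq.
exists q => //; rewrite qI andbT inE.
have [//|q1 /=] := eqVneq q 1.
apply/negPn/negP => qs.
have pq : p != q.
  apply: contraNneq qs => pq; move: ps; rewrite pq inE => /predU1P[q0|//].
  by move: qI; rewrite q0 ltxx.
have q1' : q < 1 by rewrite lt_neqAle q1; case/andP: qI.
have [u [uq u1 hu]] := nextP s q1'.
have [v [_ v0 vq hv]] := prevP s (proj1 (andP qI)).
have vu : v < u by lra.
have [|k' [c' hk']] := haf v u v0 vu u1.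
  move=> r rs; apply/negP => /andP[vr ru].
  have [rq|qr|e] := ltgtP r q.
  - by move/negP: (hv r rs); apply; rewrite vr.
  - by move/negP: (hu r rs); apply; rewrite qr.
  - by move: qs; rewrite -e rs.
have tk' := tauX_gt0 k'.
set r := tau ^ k' / tau ^ k.
have r0 : 0 < r by rewrite divr_gt0.
have key e : 0 < e -> q + e <= u -> p + r * e <= b -> q + e = p + r * e.
  move=> e0 eu eb; apply: (can_inj fg).
  rewrite hk'; last by apply/andP; split; lra.
  rewrite hk; last by rewrite ltrDl mulr_gt0.
  have h1 : tau ^ k' * q + c' = l by rewrite -hk' // vq ltW.
  have h2 : tau ^ k * (r * e) = tau ^ k' * e.
    by rewrite mulrA /r [tau ^ k * _]mulrC divfK ?gt_eqF.
  rewrite !mulrDr h2.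
  have : tau ^ k' * q + c' = tau ^ k * p + c by rewrite h1.
  lra.
set e := Num.min (u - q) ((b - p) / r).
have e0 : 0 < e by rewrite lt_min subr_gt0 uq divr_gt0 // subr_gt0.
have e1 : e <= u - q by rewrite ge_min lexx.
have e2 : r * e <= b - p.
  by rewrite -ler_pdivlMl // mulrC ge_min lexx orbT.
have re0 : 0 < r * e by rewrite mulr_gt0.
have h1 : q + e = p + r * e by apply: key; lra.
have h2 : q + e / 2 = p + r * (e / 2).
  by apply: key; [lra|lra|rewrite mulrA; lra].
move: pq; rewrite mulrA in h2; have -> : p = q by lra.
by rewrite eqxx.
Qed.

Lemma break_Ztau f g s : bij01 f g -> (forall p, p \in s -> Ztau p) -> affine_off f s ->
  forall q, q \in 1 :: s -> 0 < q <= 1 -> Ztau (f q).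
Proof.
move=> hb hs haf.
have [fg gf hI _] := hb.
have hs1 q : q \in 1 :: s -> Ztau q.
  by rewrite inE => /predU1P[->|/hs//]; exact: Ztau1.
have hs0 q : q \in 0 :: s -> Ztau q.
  by rewrite inE => /predU1P[->|/hs//]; exact: Ztau0.
set s1 := 1 :: s.
pose cnt (q : R) := count (fun r => f r < f q) s1.
suff H n q : (cnt q < n)%N -> q \in s1 -> 0 < q <= 1 -> Ztau (f q).
  by move=> q; exact: (H (cnt q).+1).
elim: n q => // n IH q cn qs qI.
have [p [k [c [ps /andP[p0 pq] hk l0 hl]]]] := pieceP hb haf qI.
have -> : f q = (tau ^ k * p + c) + tau ^ k * (q - p).
  by rewrite hk ?pq ?lexx //; ring.
apply: ZtauD; last by apply: ZtauM; [exact: ZtauX|apply: ZtauB; auto].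
case: hl => [->|[r /andP[rs rI] fr]]; first exact: Ztau0.
rewrite -fr; apply: IH => //.
have frq : f r < f q by rewrite fr hk ?pq ?lexx // ltrD2r ltr_pM2l // tauX_gt0.
move: cn; rewrite ltnS; apply: leq_trans.
have : (cnt r + count (fun t => t == r) s1 <= cnt q)%N.
  rewrite -count_predUI [X in (_ + X)%N](_ : _ = 0)%N ?addn0.
    apply: sub_count => t /= /orP[h|/eqP->//]; exact: lt_trans frq.
  apply/eqP; rewrite -leqn0 -ltnS ltnNge -has_count; apply/hasPn => t _ /=.
  by apply/negP => /andP[h /eqP e]; move: h; rewrite e ltxx.
apply: leq_trans; rewrite -addn1 leq_add2l -has_count.
by apply/hasP; exists r => /=.
Qed.

Lemma aff_sub f s s' : {subset s <= s'} -> affine_off f s -> affine_off f s'.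
Proof.
by move=> ss haf a b a0 ab b1 hp; apply: haf => // p /ss; exact: hp.
Qed.

Lemma aff_Ztau f g s : bij01 f g -> (forall p, p \in s -> Ztau p) -> affine_off f s ->
  forall q, Ztau q -> Ztau (f q).
Proof.
move=> hb hs haf q hq; have [qI|qI] := boolP (0 < q <= 1); last first.
  by case: hb => _ _ _ ->.
apply: (break_Ztau hb (s := q :: s)) => //.
- by move=> p; rewrite inE => /predU1P[->|/hs].
- by apply: aff_sub haf => p ps; rewrite inE ps orbT.
- by rewrite !inE eqxx orbT.
Qed.

Lemma affV f g s : bij01 f g -> affine_off f s -> affine_off g (map f (1 :: s)).
Proof.
move=> hb haf a b a0 ab b1 hp.
have [fg gf hI _] := hb.
have bI : 0 < b <= 1 by apply/andP; split; lra.
have gbI : 0 < g b <= 1 by rewrite -hI gf.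
have [p [k [c [_ /andP[p0 pb] hk l0 hl]]]] := pieceP hb haf gbI.
have tk := tauX_gt0 k.
have fb : tau ^ k * g b + c = b by rewrite -hk ?gf // pb lexx.
have la : tau ^ k * p + c <= a.
  case: hl => [->//|[q /andP[qs _] fq]].
  rewrite leNgt; apply/negP => al; move/negP: (hp (f q) (map_f f qs)); apply.
  by rewrite fq al -[ltRHS]fb ltrD2r ltr_pM2l.
exists (- k), (- (tau ^ (- k) * c)) => x /andP[ax xb].
apply: (can_inj fg); rewrite gf hk.
  rewrite mulrBr !mulrA -invr_expz mulfV ?gt_eqF // !mul1r; ring.
rewrite -invr_expz -mulrBr -ltr_pdivrMl ?invr_gt0 // -ler_pdivlMl ?invr_gt0 //.
rewrite invrK; apply/andP; split; lra.
Qed.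

Lemma aff_comp f g f' g' s s' : bij01 f g -> bij01 f' g' ->
  affine_off f s -> affine_off f' s' -> affine_off (f \o f') (s' ++ map g' s).
Proof.
move=> hb [fg' gf' hI' _] haf haf' a b a0 ab b1 hp.
have [p|k [c hk]] := haf' a b a0 ab b1.
  by move=> ps; apply: hp; rewrite mem_cat ps.
have tk := tauX_gt0 k.
have hf' x : a < x <= b -> 0 < tau ^ k * x + c <= 1.
  by move=> hx; rewrite -hk // hI'; case/andP: hx => *; apply/andP; split; lra.
have [|||q qs|k2 [c2 hk2]] := haf (tau ^ k * a + c) (tau ^ k * b + c).
- by apply: (left_end_ge0 ab) => x /hf'/andP[].
- by rewrite ltrD2r ltr_pM2l.
- by have := hf' b; rewrite ab lexx => /(_ isT)/andP[].
- apply/negP => /andP[h1 h2].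
  set y := (q - c) / tau ^ k.
  have yk : tau ^ k * y = q - c by rewrite /y mulrC divfK ?gt_eqF.
  have ya : a < y by rewrite -(ltr_pM2l tk) yk; lra.
  have yb : y < b by rewrite -(ltr_pM2l tk) yk; lra.
  have gy : g' q = y.
    by apply: (can_inj fg'); rewrite gf' hk ?yk ?ya ?ltW // subrK.
  by have := hp (g' q); rewrite mem_cat map_f ?orbT // gy ya yb => /(_ isT).
exists (k2 + k), (tau ^ k2 * c + c2) => x /andP[ax xb] /=.
rewrite hk ?ax // hk2; last first.
  by rewrite ltrD2r lerD2r ltr_pM2l // ler_pM2l // ax.
rewrite expfzDr ?gt_eqF ?tau_gt0 //; ring.
Qed.

Lemma aff_is_Vtau f g s : bij01 f g -> (forall p, p \in s -> Ztau p) ->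
  affine_off f s -> is_Vtau f.
Proof.
move=> hb hs haf; have [fg gf hI ho] := hb; split.
- exact: bij01_set_bij hb.
- by move=> x; rewrite in01 => /negP; exact: ho.
- move=> b; rewrite in01 => hbI.
  have [p [k [c [_ /andP[p0 pb] hk _ _]]]] := pieceP hb haf hbI.
  rewrite hk ?pb ?lexx //.
  apply: cvg_trans (@aff_cvg k c b); apply: near_eq_cvg.
  near=> y; apply/esym/hk; apply/andP; split; near: y.
  + exact: nbhs_left_gt.
  + exact: nbhs_left_le.
- exists s; split=> // a b ab hab hp.
  have habI x : a < x -> x < b -> 0 < x <= 1.
    by move=> ax xb; have := hab x; rewrite /= !in_itv /= ax xb; exact.
  have a0 : 0 <= a.
    rewrite leNgt; apply/negP => an.
    have [|y ay] := @mid a (Num.min b 0); first by rewrite lt_min ab.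
    by rewrite lt_min => /andP[yb y0]; have /andP[] := habI y ay yb; lra.
  have b1 : b <= 1.
    rewrite leNgt; apply/negP => bn.
    have [|y] := @mid (Num.max a 1) b; first by rewrite gt_max ab.
    by rewrite gt_max => /andP[ay y0] yb; have /andP[] := habI y ay yb; lra.
  have [p ps|k [c hk]] := haf a b a0 ab b1.
    by apply/negP => h; apply: (hp p ps); rewrite /= in_itv.
  exists k, c => x /=; rewrite in_itv /= => /andP[ax xb].
  by apply: hk; rewrite ax ltW.
Unshelve. all: by end_near.
Qed.

Lemma is_Vtau_ex f : is_Vtau f -> exists g s,
  [/\ bij01 f g, (forall p, p \in s -> Ztau p) & affine_off f s].
Proof.
move=> hf; have [h1 h2 _ _] := hf.
by have [g hg] := bij01P h1 h2; have [s [hs ha]] := affP hf; exists g, s.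
Qed.

Lemma is_Vtau_id : is_Vtau id.
Proof.
apply: (@aff_is_Vtau id id [::]) => // a b _ _ _ _.
by exists 0, 0 => x _; rewrite expr0z mul1r addr0.
Qed.

Lemma is_VtauV f : is_Vtau f ->
  exists g, [/\ is_Vtau g, cancel f g & cancel g f].
Proof.
move=> /is_Vtau_ex[g [s [hb hs ha]]]; have [fg gf _ _] := hb.
exists g; split=> //; apply: (aff_is_Vtau (bij01_sym hb) _ (affV hb ha)).
move=> p /mapP[q + ->]; rewrite inE => /predU1P[->|/hs].
  exact: (aff_Ztau hb hs ha Ztau1).
exact: aff_Ztau hb hs ha _.
Qed.

Lemma is_Vtau_comp f f' : is_Vtau f -> is_Vtau f' -> is_Vtau (f \o f').
Proof.
move=> /is_Vtau_ex[g [s [hb hs ha]]] /is_Vtau_ex[g' [s' [hb' hs' ha']]].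
apply: (aff_is_Vtau (bij01_comp hb hb') _ (aff_comp hb hb' ha ha')).
move=> p; rewrite mem_cat => /orP[/hs'//|/mapP[q /hs + ->]].
apply: (aff_Ztau (bij01_sym hb') _ (affV hb' ha')) => r /mapP[t + ->].
rewrite inE => /predU1P[->|/hs'].
  exact: (aff_Ztau hb' hs' ha' Ztau1).
exact: aff_Ztau hb' hs' ha' _.
Qed.

(* The product f * g of the group structure below is f \o g. *)
Record Vtau := MkVtau { Vtau_fun :> R -> R; _ : `[< is_Vtau Vtau_fun >] }.

HB.instance Definition _ := [isSub for Vtau_fun].
HB.instance Definition _ := [Choice of Vtau by <:].

Lemma VtauP (f : Vtau) : is_Vtau f.
Proof. by case: f => f /= /asboolP. Qed.

Lemma Vtau_inv_ex (f : Vtau) : exists g : Vtau, cancel f g /\ cancel g f.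
Proof.
have [g [/asboolP hg fg gf]] := is_VtauV (VtauP f).
by exists (MkVtau hg).
Qed.

Definition Vtau_one : Vtau := MkVtau (asboolT is_Vtau_id).
Definition Vtau_mul (f g : Vtau) : Vtau :=
  MkVtau (asboolT (is_Vtau_comp (VtauP f) (VtauP g))).
Definition Vtau_inv (f : Vtau) : Vtau := projT1 (cid (Vtau_inv_ex f)).

Lemma Vtau_funK (f : Vtau) : cancel f (Vtau_inv f).
Proof. by rewrite /Vtau_inv; case: cid => g []. Qed.

Lemma Vtau_invK (f : Vtau) : cancel (Vtau_inv f) f.
Proof. by rewrite /Vtau_inv; case: cid => g []. Qed.

Lemma Vtau_mulA : associative Vtau_mul.
Proof. by move=> f g h; apply: val_inj. Qed.
Lemma Vtau_mul1 : left_id Vtau_one Vtau_mul.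
Proof. by move=> f; apply: val_inj. Qed.
Lemma Vtau_mulr1 : right_id Vtau_one Vtau_mul.
Proof. by move=> f; apply: val_inj. Qed.
Lemma Vtau_mulV : left_inverse Vtau_one Vtau_inv Vtau_mul.
Proof. by move=> f; apply/val_inj/funext => x; exact: Vtau_funK. Qed.
Lemma Vtau_mulrV : right_inverse Vtau_one Vtau_inv Vtau_mul.
Proof. by move=> f; apply/val_inj/funext => x; exact: Vtau_invK. Qed.

HB.instance Definition _ := isGroup.Build Vtau
  Vtau_mulA Vtau_mul1 Vtau_mulr1 Vtau_mulV Vtau_mulrV.

End Vtau.

Section Circle.
Variable R : realType.

Definition unit_itv : set R := `[0, 1].

Definition is_end (u : unit_itv) : bool := (val u == 0) || (val u == 1).

Definition glue_rel (u v : unit_itv) : bool := (u == v) || is_end u && is_end v.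

Lemma glue_rel_refl : reflexive glue_rel.
Proof. by move=> u; rewrite /glue_rel eqxx. Qed.

Lemma glue_rel_sym : symmetric glue_rel.
Proof. by move=> u v; rewrite /glue_rel eq_sym andbC. Qed.

Lemma glue_rel_trans : transitive glue_rel.
Proof.
move=> v u w /predU1P[-> //|] + /predU1P[<- //|]; rewrite /glue_rel.
by move=> /andP[-> _] /andP[_ ->]; rewrite orbT.
Qed.

Definition glue := EquivRel _ glue_rel_refl glue_rel_sym glue_rel_trans.

Local Open Scope quotient_scope.

Definition circle := {eq_quot glue}.

HB.instance Definition _ := Quotient.on circle.
HB.instance Definition _ := Topological.copy circle (quotient_topology circle).

Definition circle_pt (u : unit_itv) : circle := \pi_circle u.

Lemma frac_unit_itv (t : R) : (t - (Num.floor t)%:~R) \in unit_itv.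
Proof.
rewrite inE /unit_itv /= in_itv /=; have /andP[] := real_floor_itv (num_real t).
by rewrite intrD; move=> *; apply/andP; split; lra.
Qed.

Definition circle_cover (t : R) : circle :=
  circle_pt (exist _ (t - (Num.floor t)%:~R) (frac_unit_itv t)).

Definition homeomorphism (phi : circle -> circle) : Prop :=
  exists psi : circle -> circle,
    [/\ cancel phi psi, cancel psi phi, continuous phi & continuous psi].

(* phi lifts, through the universal covering of the circle, to an increasing
   homeomorphism of the line. *)
Definition orientation_preserving (phi : circle -> circle) : Prop :=
  exists F G : R -> R,
    [/\ cancel F G, cancel G F, continuous F & continuous G] /\
    {homo F : s t / s < t} /\
    (forall t, phi (circle_cover t) = circle_cover (F t)).

(* Each point of the circle is the class of exactly one point of (0,1], so f
   determines phi; the value f u = 1 is the class of 0. *)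
Definition induces (f : R -> R) (phi : circle -> circle) : Prop :=
  forall u v : unit_itv, 0 < val u -> val v = f (val u) ->
    phi (circle_pt u) = circle_pt v.

Definition is_Ttau (f : Vtau R) : Prop :=
  exists phi, [/\ induces f phi, homeomorphism phi & orientation_preserving phi].

Definition in_Ttau : {pred Vtau R} := fun f => `[< is_Ttau f >].

Lemma is_Ttau_one : is_Ttau 1%g.
Proof.
exists id; split.
- by move=> u v _ /= /val_inj ->.
- by exists id; split=> // x; exact: cvg_id.
- by exists id, id; split=> //; split=> // x; exact: cvg_id.
Qed.

Lemma is_Ttau_comp f g : is_Ttau f -> is_Ttau g -> is_Ttau (f * g)%g.
Proof.
move=> [phi [fphi [phi' [k1 k2 c1 c2]] [F [F' [[h1 h2 h3 h4] [hF hphi]]]]]].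
move=> [psi [fpsi [psi' [l1 l2 d1 d2]] [G [G' [[i1 i2 i3 i4] [hG hpsi]]]]]].
exists (phi \o psi); split.
- move=> u v u0 /= hv.
  have hgu : 0 < g (val u) <= 1.
    have [[h _ _] _ _ _] := VtauP g.
    have := h (val u); rewrite /= !in_itv /= => -> //.
    by rewrite u0; have := valP u; rewrite inE /unit_itv /= in_itv /= => /andP[].
  have gI : g (val u) \in unit_itv.
    by rewrite inE /unit_itv /= in_itv /=; case/andP: hgu => *; apply/andP; split; lra.
  rewrite (fpsi u (exist (fun z => z \in unit_itv) _ gI)) //; apply: fphi => //=.
  by case/andP: hgu.
- exists (psi' \o phi'); split.
  + by move=> x /=; rewrite k1 l1.
  + by move=> x /=; rewrite l2 k2.
  + by move=> x; apply: continuous_comp; [exact: d1|exact: c1].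
  + by move=> x; apply: continuous_comp; [exact: c2|exact: d2].
- exists (F \o G), (G' \o F'); split; first split.
  + by move=> x /=; rewrite h1 i1.
  + by move=> x /=; rewrite i2 h2.
  + by move=> x; apply: continuous_comp; [exact: i3|exact: h3].
  + by move=> x; apply: continuous_comp; [exact: h4|exact: i4].
  + split=> [x y xy /=|t /=]; first by apply: hF; apply: hG.
    by rewrite hpsi hphi.
Qed.

Lemma is_Ttau_inv f : is_Ttau f -> is_Ttau f^-1%g.
Proof.
move=> [phi [fphi [phi' [k1 k2 c1 c2]] [F [F' [[h1 h2 h3 h4] [hF hphi]]]]]].
exists phi'; split.
- move=> u v u0 hv; have hu : val u = f (val v) by rewrite hv Vtau_invK.
  have v0 : 0 < val v.
    have [[h _ _] _ _ _] := VtauP (f^-1)%g.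
    have := h (val u); rewrite /= !in_itv /= hv => h'.
    apply: (proj1 (andP (h' _))).
    by rewrite u0; have := valP u; rewrite inE /unit_itv /= in_itv /= => /andP[].
  by rewrite -(fphi v u v0 hu) k1.
- by exists phi.
- exists F', F; split=> //; split=> [x y xy|t]; last first.
    by rewrite -[in LHS](h2 t) -hphi k1.
  have [//|yx|e] := ltgtP (F' x) (F' y).
    by move/hF: yx; rewrite !h2; lra.
  by have := congr1 F e; rewrite !h2; lra.
Qed.

Lemma in_Ttau_closed : group_closed in_Ttau.
Proof.
split; first exact/asboolP/is_Ttau_one.
move=> f g /asboolP hf /asboolP hg; apply/asboolP.
by apply: is_Ttau_comp => //; exact: is_Ttau_inv.
Qed.

Record Ttau := MkTtau { Ttau_val :> Vtau R; _ : in_Ttau Ttau_val }.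

HB.instance Definition _ := [isSub for Ttau_val].
HB.instance Definition _ := [Choice of Ttau by <:].
HB.instance Definition _ :=
  SubChoice_isSubGroup.Build (Vtau R) in_Ttau Ttau in_Ttau_closed.

End Circle.

Inductive caret := xcaret | ycaret.

Inductive tree := Leaf | Node of caret & tree & tree.

Fixpoint nleaves (t : tree) : nat :=
  if t is Node _ l r then (nleaves l + nleaves r)%N else 1%N.

(* attach t i t' replaces leaf number i of t by t'. *)
Fixpoint attach (t : tree) (i : nat) (t' : tree) : tree :=
  match t with
  | Leaf => if i == 0%N then t' else Leaf
  | Node c l r =>
      if (i < nleaves l)%N then Node c (attach l i t') r
      else Node c l (attach r (i - nleaves l) t')
  end.

Fixpoint spine (m : nat) : tree :=
  if m is m'.+1 then Node xcaret Leaf (spine m') else Leaf.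

Definition spine_with (c : caret) (n : nat) : tree :=
  attach (spine n.+1) n (Node c Leaf Leaf).

Lemma nleaves_gt0 t : (0 < nleaves t)%N.
Proof. by elim: t => //= c l hl r hr; rewrite addn_gt0 hl. Qed.

Lemma nleaves_spine m : nleaves (spine m) = m.+1.
Proof. by elim: m => //= m ->. Qed.

Lemma nleaves_attach t i t' : (i < nleaves t)%N ->
  (nleaves (attach t i t')).+1 = (nleaves t + nleaves t')%N.
Proof.
elim: t i => [|c l hl r hr] i /=; first by rewrite ltnS leqn0 => ->.
move=> hi; case: (ltnP i (nleaves l)) => h /=; first by rewrite -addSn hl // addnAC.
by rewrite -addnS hr ?addnA // ltn_subLR.
Qed.

Lemma nleaves_spine_with c n : nleaves (spine_with c n) = n.+3.
Proof.
have := @nleaves_attach (spine n.+1) n (Node c Leaf Leaf).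
by rewrite nleaves_spine => /(_ (leqnSn _)) [->]; rewrite addn2.
Qed.

Section Trees.
Variable R : realType.

Definition cut (c : caret) (a b : R) : R :=
  a + tau R ^+ (if c is xcaret then 2 else 1) * (b - a).

(* The intervals (u,v] of the leaves of t, with root (a,b], as pairs (u,v). *)
Fixpoint leaves (t : tree) (a b : R) : seq (R * R) :=
  match t with
  | Leaf => [:: (a, b)]
  | Node c l r => leaves l a (cut c a b) ++ leaves r (cut c a b) b
  end.

Definition leaf (t : tree) (i : nat) : R * R := nth (0, 0) (leaves t 0 1) i.

(* The map represented by (T1, p, T2), extended by the identity. *)
Definition tree_fun k (T1 : tree) (p : 'S_k) (T2 : tree) (x : R) : R :=
  if [pick i : 'I_k | (leaf T2 i).1 < x <= (leaf T2 i).2] is Some i then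
    let: (a, b) := leaf T2 i in
    let: (a', b') := leaf T1 (p i) in
    a' + (b' - a') / (b - a) * (x - a)
  else x.

Lemma size_leaves t a b : size (leaves t a b) = nleaves t.
Proof. by elim: t a b => //= c l hl r hr a b; rewrite size_cat hl hr. Qed.

Lemma tau_lt1 : tau R < 1.
Proof. by have := tau_eq R; have := exprn_gt0 2 (tau_gt0 R); lra. Qed.

Lemma cutP c a b : a < b -> a < cut c a b < b /\
  exists k l : int, cut c a b - a = tau R ^ k * (b - a) /\
                    b - cut c a b = tau R ^ l * (b - a).
Proof.
move=> ab; have te := tau_eq R; have t0 := tau_gt0 R; have t1 := tau_lt1.
have ba : 0 < b - a by lra.
have t20 : 0 < tau R ^+ 2 by rewrite exprn_gt0.
have e1 : 0 < tau R * (b - a) by rewrite mulr_gt0.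
have e2 : 0 < tau R ^+ 2 * (b - a) by rewrite mulr_gt0.
have e : b - a = tau R * (b - a) + tau R ^+ 2 * (b - a) by rewrite -mulrDl -te mul1r.
rewrite /cut; case: c; rewrite ?expr1; split.
- by apply/andP; split; lra.
- by exists 2, 1; rewrite expr1z -exprnP; split; lra.
- by apply/andP; split; lra.
- by exists 1, 2; rewrite expr1z -exprnP; split; lra.
Qed.

Lemma leavesP t a b i : a < b -> (i < nleaves t)%N ->
  let: (u, v) := nth (0, 0) (leaves t a b) i in
  [/\ a <= u, u < v, v <= b & exists k : int, v - u = tau R ^ k * (b - a)].
Proof.
elim: t a b i => [|c l hl r hr] a b i ab /=.
  by rewrite ltnS leqn0 => /eqP -> /=; split=> //; exists 0; rewrite mul1r.
move=> hi; have [/andP[h1 h2] [k1 [k2 [e1 e2]]]] := cutP c ab.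
rewrite nth_cat size_leaves; case: ltnP => h.
  have := hl _ _ _ h1 h; case: nth => u v [h3 h4 h5 [k ek]].
  split=> //; first lra; exists (k + k1).
  by rewrite ek e1 expfzDr ?gt_eqF ?tau_gt0 // mulrA.
have h' : (i - nleaves l < nleaves r)%N by rewrite ltn_subLR.
have := hr _ _ _ h2 h'; case: nth => u v [h3 h4 h5 [k ek]].
split=> //; first lra; exists (k + k2).
by rewrite ek e2 expfzDr ?gt_eqF ?tau_gt0 // mulrA.
Qed.

Lemma leaves_Ztau t a b i : Ztau a -> Ztau b -> (i < nleaves t)%N ->
  Ztau (nth (0, 0) (leaves t a b) i).1 /\ Ztau (nth (0, 0) (leaves t a b) i).2.
Proof.
elim: t a b i => [|c l hl r hr] a b i ha hb /=.
  by rewrite ltnS leqn0 => /eqP -> /=.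
have hc : Ztau (cut c a b).
  by apply: ZtauD => //; apply: ZtauM; [rewrite exprnP; exact: ZtauX|exact: ZtauB].
move=> hi; rewrite nth_cat size_leaves; case: ltnP => h; first exact: hl.
by apply: hr => //; rewrite ltn_subLR.
Qed.

Lemma leaves_cover t a b x : a < b -> a < x <= b ->
  exists2 i, (i < nleaves t)%N & (nth (0, 0) (leaves t a b) i).1 < x
                                 <= (nth (0, 0) (leaves t a b) i).2.
Proof.
elim: t a b => [|c l hl r hr] a b ab hx /=; first by exists 0%N.
have [/andP[h1 h2] _] := cutP c ab; case/andP: hx => ax xb.
have [h|h] := leP x (cut c a b).
  have [i hi hi'] := hl _ _ h1 (introT andP (conj ax h)).
  by exists i; rewrite ?ltn_addr // nth_cat size_leaves hi.
have [i hi hi'] := hr _ _ h2 (introT andP (conj h xb)).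
exists (nleaves l + i)%N; first by rewrite ltn_add2l.
by rewrite nth_cat size_leaves ltnNge leq_addr /= addKn.
Qed.

Lemma leaves_sorted t a b i j : a < b -> (i < j)%N -> (j < nleaves t)%N ->
  (nth (0, 0) (leaves t a b) i).2 <= (nth (0, 0) (leaves t a b) j).1.
Proof.
elim: t a b i j => [|c l hl r hr] a b i j ab ij /=.
  by rewrite ltnS leqn0 => /eqP j0; rewrite j0 in ij.
have [/andP[h1 h2] _] := cutP c ab.
move=> hj; rewrite !nth_cat !size_leaves.
case: (ltnP j (nleaves l)) => h.
  by rewrite (ltn_trans ij h); exact: hl.
have h' : (j - nleaves l < nleaves r)%N by rewrite ltn_subLR.
case: ltnP => hi; last first.
  by apply: hr => //; apply: ltn_sub2r => //; exact: leq_ltn_trans ij.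
have := leavesP h1 hi; have := leavesP h2 h'.
by case: nth => u v [? ? ? _]; case: nth => u' v' [? ? ? _] /=; lra.
Qed.

Lemma leafP t i : (i < nleaves t)%N ->
  [/\ 0 <= (leaf t i).1, (leaf t i).1 < (leaf t i).2, (leaf t i).2 <= 1 &
    exists k : int, (leaf t i).2 - (leaf t i).1 = tau R ^ k].
Proof.
move=> hi; have := leavesP (ltr01 : 0 < 1 :> R) hi; rewrite /leaf.
by case: nth => u v [? ? ? [k hk]] /=; split=> //; exists k; rewrite hk; ring.
Qed.

Lemma leaf_uniq t i j x : (i < nleaves t)%N -> (j < nleaves t)%N ->
  (leaf t i).1 < x <= (leaf t i).2 -> (leaf t j).1 < x <= (leaf t j).2 -> i = j.
Proof.
move=> hi hj /andP[h1 h2] /andP[h3 h4]; have [ij|ij|//] := ltngtP i j.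
  have h : (leaf t i).2 <= (leaf t j).1 by exact: leaves_sorted.
  by have := lt_le_trans h3 (le_trans h2 h); rewrite ltxx.
have h : (leaf t j).2 <= (leaf t i).1 by exact: leaves_sorted.
by have := lt_le_trans h1 (le_trans h4 h); rewrite ltxx.
Qed.

Section TreeFun.
Variables (k : nat) (T1 T2 : tree) (p : 'S_k).
Hypotheses (h1 : nleaves T1 = k) (h2 : nleaves T2 = k).

Lemma tree_fun_in (i : 'I_k) x : (leaf T2 i).1 < x <= (leaf T2 i).2 ->
  tree_fun T1 p T2 x = (leaf T1 (p i)).1 +
   ((leaf T1 (p i)).2 - (leaf T1 (p i)).1) / ((leaf T2 i).2 - (leaf T2 i).1)
    * (x - (leaf T2 i).1).
Proof.
move=> hx; rewrite /tree_fun; case: pickP => [j hj|/(_ i)]; last by rewrite hx.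
have -> : j = i by apply/ord_inj/(leaf_uniq _ _ hj hx); rewrite h2.
by case: (leaf T2 i) => a b; case: (leaf T1 (p i)).
Qed.

Lemma tree_fun_image (i : 'I_k) x : (leaf T2 i).1 < x <= (leaf T2 i).2 ->
  (leaf T1 (p i)).1 < tree_fun T1 p T2 x <= (leaf T1 (p i)).2.
Proof.
move=> hx; rewrite (tree_fun_in hx); case/andP: hx => x1 x2.
have [|_ l1 _ _] := @leafP T1 (p i); first by rewrite h1.
have [|_ l2 _ _] := @leafP T2 i; first by rewrite h2.
set A := (leaf T1 (p i)).1 in l1 *; set B := (leaf T1 (p i)).2 in l1 *.
set a := (leaf T2 i).1 in x1 l2 *; set b := (leaf T2 i).2 in x2 l2 *.
have r0 : 0 < (B - A) / (b - a) by rewrite divr_gt0 ?subr_gt0.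
rewrite ltrDl mulr_gt0 ?subr_gt0 //= -lerBrDl.
rewrite -[leRHS](@divfK _ (b - a)) ?ler_pM2l //; first lra.
by rewrite gt_eqF ?subr_gt0.
Qed.

Lemma tree_fun_out x : ~~ (0 < x <= 1) -> tree_fun T1 p T2 x = x.
Proof.
move=> hx; rewrite /tree_fun; case: pickP => // i /andP[x1 x2].
have [|l1 _ l2 _] := @leafP T2 i; first by rewrite h2.
by case/negP: hx; apply/andP; split; lra.
Qed.

Lemma tree_fun_ex x : 0 < x <= 1 ->
  exists i : 'I_k, (leaf T2 i).1 < x <= (leaf T2 i).2.
Proof.
move=> hx; have [i hi hxi] := leaves_cover T2 ltr01 hx.
by rewrite h2 in hi; exists (Ordinal hi).
Qed.

Lemma tree_fun_I x : 0 < x <= 1 -> 0 < tree_fun T1 p T2 x <= 1.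
Proof.
move=> /tree_fun_ex[i /tree_fun_image /andP[x1 x2]].
have [|l1 _ l2 _] := @leafP T1 (p i); first by rewrite h1.
by apply/andP; split; lra.
Qed.

End TreeFun.

Lemma tree_funK k T1 T2 (p : 'S_k) : nleaves T1 = k -> nleaves T2 = k ->
  cancel (tree_fun T1 p T2) (tree_fun T2 p^-1%g T1).
Proof.
move=> h1 h2 x; have [hx|hx] := boolP (0 < x <= 1); last first.
  by rewrite !tree_fun_out.
have [i hi] := tree_fun_ex h2 hx.
have hy := tree_fun_image p h1 h2 hi.
rewrite (tree_fun_in T2 p^-1%g h1 hy) permK (tree_fun_in T1 p h2 hi).
have [|_ l1 _ _] := @leafP T1 (p i); first by rewrite h1.
have [|_ l2 _ _] := @leafP T2 i; first by rewrite h2.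
field; rewrite !subr_eq0; apply/andP; split; rewrite gt_eqF //.
Qed.

Lemma tree_fun_is_Vtau k T1 T2 (p : 'S_k) : nleaves T1 = k -> nleaves T2 = k ->
  is_Vtau (tree_fun T1 p T2).
Proof.
move=> h1 h2.
have hK := tree_funK p h1 h2.
have hK' : cancel (tree_fun T2 p^-1%g T1) (tree_fun T1 p T2).
  by have := tree_funK p^-1%g h2 h1; rewrite invgK.
have hb : bij01 (tree_fun T1 p T2) (tree_fun T2 p^-1%g T1).
  split=> // x; last exact: tree_fun_out.
  apply/idP/idP; last exact: tree_fun_I.
  by move=> /(tree_fun_I p^-1%g h2 h1); rewrite hK.
apply: (aff_is_Vtau hb (s := [seq (leaf T2 (i : 'I_k)).1 | i <- enum 'I_k])).
  move=> q /mapP[i _ ->]; apply: (proj1 (leaves_Ztau _ _ _)).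
  - exact: Ztau0.
  - exact: Ztau1.
  - by rewrite h2.
move=> a b a0 ab b1 hp.
have [i /andP[hi1 hi2]] := tree_fun_ex h2 (introT andP (conj (le_lt_trans a0 ab) b1)).
have la : (leaf T2 i).1 <= a.
  rewrite leNgt; apply/negP => al; have /negP := hp (leaf T2 i).1 (map_f _ (mem_enum _ i)).
  by rewrite al hi1.
have [|_ l1 _ [k1 e1]] := @leafP T1 (p i); first by rewrite h1.
have [|_ l2 _ [k2 e2]] := @leafP T2 i; first by rewrite h2.
exists (k1 - k2), ((leaf T1 (p i)).1 - tau R ^ (k1 - k2) * (leaf T2 i).1).
move=> x /andP[ax xb].
rewrite (tree_fun_in T1 p h2 (i := i)); last by apply/andP; split; lra.
rewrite e1 e2 expfzDr ?gt_eqF ?tau_gt0 // -invr_expz; ring.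
Qed.

Definition tree_elt k (T1 T2 : tree) (h1 : nleaves T1 = k) (h2 : nleaves T2 = k)
    (p : 'S_k) : Vtau R :=
  MkVtau (asboolT (tree_fun_is_Vtau p h1 h2)).

Definition x_gen (n : nat) : Vtau R :=
  tree_elt (nleaves_spine_with xcaret n) (nleaves_spine n.+2) 1%g.

Definition y_gen (n : nat) : Vtau R :=
  tree_elt (nleaves_spine_with ycaret n) (nleaves_spine n.+2) 1%g.

(* The permutation is i |-> i - 1 mod n + 2; only the case n >= 1 is used. *)
Definition c_gen (n : nat) : Vtau R :=
  tree_elt (nleaves_spine n.+1) (nleaves_spine n.+1) (perm (@ord_pred_inj n.+2)).

Definition pi_gen (n : nat) : Vtau R :=
  tree_elt (nleaves_spine n.+2) (nleaves_spine n.+2)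
    (tperm (inord n) (inord n.+1) : 'S_n.+3).

End Trees.

(* For a subgroup N, its left cosets g N. *)
Definition lcosets_of (G : groupType) (N : {pred G}) : set (set G) :=
  [set C | exists g, C = [set h | (g^-1 * h)%g \in N]].

Definition normal_of_index (G : groupType) (N : {pred G}) (n : nat) : Prop :=
  [/\ group_closed N,
      (forall g h : G, h \in N -> (h ^ g)%g \in N)
    & (lcosets_of N #= `I_n)%card].

(* Main.v *)
Require Import Defs.
From mathcomp Require Import all_boot all_order all_algebra all_fingroup.
From mathcomp Require Import ring lra.
From mathcomp Require Import all_classical all_reals all_analysis.
Import Order.TTheory GRing.Theory Num.Theory numFieldNormedType.Exports.

(** The parity of an element of V_tau can be read off its affine pieces.  On
    Z[tau] consider the Z/2-valued [pairing]
      B(m + n tau, p + q tau) = m p + n p + n q.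
    It is biadditive, it is unchanged when both arguments are multiplied by
    tau ([pairing_tau]), and it is not symmetric: B(1, tau) = 0 whereas
    B(tau, 1) = 1 ([pairing_1tau]).  If f is x |-> s x + c on (a, b], with s a
    power of tau, this piece of f gets the weight B(s (b - a), c), and [parity f]
    is the sum of the weights over a partition of (0,1] into such pieces.

    The weight of a piece is additive in its length, so that two partitions give
    the same sum, that of all their overlaps ([chart_weight_uniq]).  If g is
    x |-> s' x + c' on the image of the piece and l = b - a, then g \o f is
    x |-> s' s x + s' c + c' on it, and
      B(s' s l, s' c + c') = B(s l, c) + B(s' s l, c')
    by biadditivity and invariance.  The second term is the weight of the image
    interval for g; the images of the pieces of f form a partition of (0,1], in
    another order, and the sum ignores this order.  Hence parity is a
    homomorphism on V_tau ([chart_comp], [parityM]).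

    For a triple (T1, p, T2) the weight of a piece is w(u', v') + w(u, v), where
    (u, v] is a leaf of T2, (u', v'] is its image and w(u, v) = B(v - u, u).
    Cutting an interval by an x-caret preserves the sum of the values of w, and
    cutting it by a y-caret adds 1: the two cases produce B(1, tau) and B(tau, 1)
    ([itv_weight_cut]).  So the parity of a triple is the number of y-carets of
    both trees modulo 2 ([parity_tree_elt]); it is 1 on each y_n and 0 on the
    other generators.

    For T_tau, it remains to see that x_n, y_n and c_n act on the circle: a
    bijection of (0,1] that preserves the cyclic order lifts to an increasing
    bijection of the line that commutes with the integer translations, and such
    a bijection is automatically a homeomorphism ([is_Ttau_cyclic]). *)

Set Implicit Arguments.
Unset Strict Implicit.
Unset Printing Implicit Defensive.

Local Open Scope classical_set_scope.
Local Open Scope ring_scope.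

(** * The pairing on Z[tau] *)

Lemma Z2_cases (z : 'Z_2) : z = 0 \/ z = 1.
Proof. by case: z => [[|[|//]] hz]; [left|right]; apply/val_inj. Qed.

Lemma Z2_addxx (z : 'Z_2) : z + z = 0.
Proof. by case: (Z2_cases z) => ->; apply/val_inj. Qed.

Section Pairing.
Variable R : realType.
Local Notation tau := (tau R).

Lemma tau_sqr : tau ^+ 2 = 1 - tau.
Proof. by have := tau_eq R; lra. Qed.

(** The integer m^2 - m n - n^2, the norm of m + n tau, vanishes with m + n tau,
    and modulo 2 this form has only the trivial zero.  Hence the coordinates of
    an element of Z[tau] in the basis (1, tau) are well defined modulo 2. *)
Lemma norm_eq0_even (m n : int) : m%:~R + n%:~R * tau = 0 ->
  m%:~R = 0 :> 'Z_2 /\ n%:~R = 0 :> 'Z_2.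
Proof.
move=> h.
have : m * m - m * n - n * n = 0.
  apply/eqP; rewrite -(intr_eq0 R) !(rmorphB, rmorphM) /=; apply/eqP.
  set M := m%:~R in h *; set N := n%:~R in h *.
  have -> : M * M - M * N - N * N =
    (M + N * tau) * (M - N - N * tau) + N ^+ 2 * (tau ^+ 2 - (1 - tau)) by ring.
  by rewrite h tau_sqr subrr mul0r mulr0 addr0.
move/(congr1 (fun z : int => z%:~R : 'Z_2)); rewrite !(rmorphB, rmorphM) /=.
case: (Z2_cases m%:~R) => ->; case: (Z2_cases n%:~R) => -> //;
  by move/(congr1 val).
Qed.

Definition coords (x : R) : int * int :=
  xget (0, 0) [set p | x = p.1%:~R + p.2%:~R * tau].

Definition coord0 (x : R) : 'Z_2 := (coords x).1%:~R.
Definition coord1 (x : R) : 'Z_2 := (coords x).2%:~R.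

Lemma coordsE (m n : int) (x : R) : x = m%:~R + n%:~R * tau ->
  coord0 x = m%:~R /\ coord1 x = n%:~R.
Proof.
move=> h; rewrite /coord0 /coord1 /coords.
have /= := xgetPex (0, 0) (ex_intro
  (fun p : int * int => x = p.1%:~R + p.2%:~R * tau) (m, n) h).
case: xget => m' n' /= h'.
have [|h0 h1] := @norm_eq0_even (m' - m) (n' - n).
  rewrite !rmorphB /=.
  have -> : m'%:~R - m%:~R + (n'%:~R - n%:~R) * tau =
   (m'%:~R + n'%:~R * tau) - (m%:~R + n%:~R * tau) by ring.
  by rewrite -h -h' subrr.
by split; apply/eqP; rewrite -subr_eq0 -rmorphB /= ?h0 ?h1.
Qed.

Lemma coordsD x y : Ztau x -> Ztau y ->
  coord0 (x + y) = coord0 x + coord0 y /\ coord1 (x + y) = coord1 x + coord1 y.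
Proof.
move=> [m [n hx]] [p [q hy]].
have [-> ->] := coordsE hx; have [-> ->] := coordsE hy.
rewrite -!rmorphD /=; apply: coordsE; rewrite hx hy !rmorphD /=; ring.
Qed.

Lemma coords_tau x : Ztau x ->
  coord0 (tau * x) = coord1 x /\ coord1 (tau * x) = coord0 x + coord1 x.
Proof.
move=> [m [n hx]]; have [-> ->] := coordsE hx.
have [|-> ->] := @coordsE n (m - n) (tau * x).
  rewrite hx rmorphB /= mulrDr mulrCA -expr2 tau_sqr; ring.
split=> //; rewrite rmorphB /=.
by rewrite -[LHS]addr0 -(Z2_addxx n%:~R) addrA subrK.
Qed.

(** Its antisymmetrization B(x, y) - B(y, x) is the determinant modulo 2 in the basis
    (1, tau). *)
Definition pairing (x y : R) : 'Z_2 :=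
  coord0 x * coord0 y + coord1 x * coord0 y + coord1 x * coord1 y.

Lemma pairingDl x y z : Ztau x -> Ztau y ->
  pairing (x + y) z = pairing x z + pairing y z.
Proof. by rewrite /pairing => hx hy; have [-> ->] := coordsD hx hy; ring. Qed.

Lemma pairingDr x y z : Ztau x -> Ztau y ->
  pairing z (x + y) = pairing z x + pairing z y.
Proof. by rewrite /pairing => hx hy; have [-> ->] := coordsD hx hy; ring. Qed.

Lemma pairing0l x : pairing 0 x = 0.
Proof.
by apply: (@addrI _ (pairing 0 x)); rewrite -pairingDl ?addr0 //; exact: Ztau0.
Qed.

Lemma pairing0r x : pairing x 0 = 0.
Proof.
by apply: (@addrI _ (pairing x 0)); rewrite -pairingDr ?addr0 //; exact: Ztau0.
Qed.

Lemma pairingNr x y : Ztau y -> pairing x (- y) = pairing x y.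
Proof.
move=> hy; apply: (@addIr _ (pairing x y)).
by rewrite -pairingDr ?addNr ?pairing0r ?Z2_addxx //; exact: ZtauN.
Qed.

Lemma pairing_sum (I : eqType) (s : seq I) (F : I -> R) y :
  (forall i, i \in s -> Ztau (F i)) ->
  pairing (\sum_(i <- s) F i) y = \sum_(i <- s) pairing (F i) y.
Proof.
move=> hF; suff [] : Ztau (\sum_(i <- s) F i) /\
  pairing (\sum_(i <- s) F i) y = \sum_(i <- s) pairing (F i) y by [].
elim: s hF => [|i s ih] hF; first by rewrite !big_nil pairing0l; split=> //; exact: Ztau0.
have [|hs ihs] := ih; first by move=> j js; apply: hF; rewrite inE js orbT.
have hi : Ztau (F i) by apply: hF; rewrite mem_head.
by rewrite !big_cons pairingDl // ihs; split=> //; exact: ZtauD.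
Qed.

Lemma pairing_tau x y : Ztau x -> Ztau y -> pairing (tau * x) (tau * y) = pairing x y.
Proof.
move=> hx hy; rewrite /pairing.
have [-> ->] := coords_tau hx; have [-> ->] := coords_tau hy.
by case: (Z2_cases (coord0 x)) => ->; case: (Z2_cases (coord1 x)) => ->;
   case: (Z2_cases (coord0 y)) => ->; case: (Z2_cases (coord1 y)) => ->; apply/val_inj.
Qed.

Lemma pairingX (k : int) x y : Ztau x -> Ztau y ->
  pairing (tau ^ k * x) (tau ^ k * y) = pairing x y.
Proof.
have nat_case (n : nat) u v : Ztau u -> Ztau v ->
    pairing (tau ^+ n * u) (tau ^+ n * v) = pairing u v.
  move=> hu hv; elim: n => [|n ih]; first by rewrite !mul1r.
  rewrite exprS -2!(mulrA tau) pairing_tau // exprnP; apply: ZtauM => //; exact: ZtauX.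
case: k => n hx hy; first exact: nat_case.
rewrite NegzE -exprnN -(nat_case n.+1) ?mulVKf ?expf_neq0 ?gt_eqF ?tau_gt0 //.
- by apply: ZtauM => //; rewrite exprnN; exact: ZtauX.
- by apply: ZtauM => //; rewrite exprnN; exact: ZtauX.
Qed.

Lemma pairing_1tau : pairing 1 tau = 0 /\ pairing tau 1 = 1.
Proof.
have [|h1 h2] := @coordsE 1 0 1; first by rewrite mul0r addr0.
have [|h3 h4] := @coordsE 0 1 tau; first by rewrite mul1r add0r.
by rewrite /pairing h1 h2 h3 h4; split; apply/val_inj.
Qed.

End Pairing.

(** * Overlaps of intervals *)

Section Overlap.
Variable R : realType.
Implicit Types (p q : R * R) (L : seq (R * R)) (x a b : R).

Definition inside q x := q.1 < x <= q.2.

(** The point of the closed interval [q.1, q.2] nearest to x. *)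
Definition clamp q x := Num.min (Num.max x q.1) q.2.

(** The length of the intersection of p and q, written as an increment so that
    it is additive in p. *)
Definition overlap p q := clamp q p.2 - clamp q p.1.

Lemma clamp_low q x : q.1 <= q.2 -> x <= q.1 -> clamp q x = q.1.
Proof. by rewrite /clamp => h1 h2; rewrite (max_idPr h2) (min_idPl h1). Qed.

Lemma clamp_high q x : q.2 <= x -> clamp q x = q.2.
Proof. by move=> h; apply/min_idPr; rewrite le_max h. Qed.

Lemma clamp_mid q x : q.1 <= x -> x <= q.2 -> clamp q x = x.
Proof. by rewrite /clamp => h1 h2; rewrite (max_idPl h1) (min_idPl h2). Qed.

Lemma overlapE p q : p.1 <= p.2 -> q.1 <= q.2 ->
  overlap p q = Num.max 0 (Num.min p.2 q.2 - Num.max p.1 q.1).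
Proof.
move=> hp hq; rewrite /overlap.
case: (leP p.2 q.2) => h2; case: (leP p.1 q.1) => h1.
- rewrite (clamp_low hq h1); case: (leP p.2 q.1) => h.
    by rewrite (clamp_low hq h) subrr max_l // subr_le0.
  by rewrite clamp_mid ?max_r ?subr_ge0 // ltW.
- by rewrite !clamp_mid ?max_r ?subr_ge0 //; lra.
- by rewrite (clamp_low hq h1) clamp_high ?max_r ?subr_ge0 // ltW.
- rewrite (clamp_high (ltW h2)); case: (leP q.2 p.1) => h.
    by rewrite clamp_high // subrr max_l // subr_le0.
  by rewrite clamp_mid ?max_r ?subr_ge0 // ltW.
Qed.

Lemma overlapC p q : p.1 <= p.2 -> q.1 <= q.2 -> overlap p q = overlap q p.
Proof. by move=> hp hq; rewrite !overlapE // (minC p.2) (maxC p.1). Qed.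

Lemma overlap_gt0 p q : p.1 < p.2 -> q.1 < q.2 -> overlap p q != 0 ->
  Num.max p.1 q.1 < Num.min p.2 q.2.
Proof.
move=> hp hq; apply: contraR; rewrite -leNgt overlapE ?(ltW hp) ?(ltW hq) // => h.
by rewrite max_l // subr_le0.
Qed.

Lemma clamp_Ztau q x : Ztau q.1 -> Ztau q.2 -> Ztau x -> Ztau (clamp q x).
Proof. by rewrite /clamp => h1 h2 h3; repeat case: leP => ?. Qed.

(** By induction on the number of endpoints of intervals of L that are interior
    to p: cutting p at such an endpoint adds both sides up, and if there is none
    then p lies inside one interval of L and misses the others. *)
Lemma overlap_sum L p : (forall q, q \in L -> q.1 <= q.2) -> p.1 <= p.2 ->
  (forall x, inside p x -> count (fun q => inside q x) L = 1%N) ->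
  \sum_(q <- L) overlap p q = p.2 - p.1.
Proof.
case: p => a b /= hL; set E := map fst L ++ map snd L.
have [n] := ubnP (count (fun e => a < e < b) E).
elim: n a b => // n ih a b hn ab h1.
have [/hasP[e eE /andP[ae eb]]|/hasPn hE] := boolP (has (fun e => a < e < b) E).
  have split_lt (P : pred R) : ~~ P e -> (forall x, P x -> a < x < b) ->
      (count P E < n)%N.
    move=> Pe hP; rewrite -ltnS; apply: leq_trans hn; rewrite ltnS.
    have : (count P E + count (pred1 e) E <= count (fun e => (a < e < b)%R) E)%N.
      rewrite -count_predUI [X in (_ + X)%N](_ : _ = 0)%N ?addn0.
        by apply: sub_count => x /= /orP[/hP//|/eqP->]; rewrite ae.
      by apply/eqP; rewrite -leqn0 leqNgt -has_count; apply/hasPn => x _ /=;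
        apply: contra Pe => /andP[+ /eqP <-].
    by apply: leq_trans; rewrite -addn1 leq_add2l -has_count; apply/hasP; exists e => /=.
  have -> : b - a = (e - a) + (b - e) by ring.
  rewrite -(ih a e) ?(ltW ae) //; last 2 first.
  - by apply: split_lt => [|x /andP[ax xe]]; rewrite ?ltxx ?andbF // ax (lt_trans xe).
  - by move=> x /andP[/= ax xe]; apply: h1; rewrite /inside /= ax (le_trans xe) // ltW.
  rewrite -(ih e b) ?(ltW eb) //; last 2 first.
  - by apply: split_lt => [|x /andP[ex xb]]; rewrite ?ltxx // xb (lt_trans ae).
  - by move=> x /andP[/= ex xb]; apply: h1; rewrite /inside /= xb (lt_trans ae).
  by rewrite -big_split; apply: eq_bigr => q _; rewrite /overlap /=; ring.
have [->|nab] := eqVneq a b.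
  by rewrite subrr big1 // => q _; rewrite /overlap subrr.
have {}ab : a < b by rewrite lt_neqAle nab.
(* No endpoint is interior to (a, b]: an interval of L that contains b contains
   (a, b]. *)
transitivity (\sum_(q <- L) if inside q b then b - a else 0).
  apply: eq_big_seq => q qL.
  have e1 : ~~ (a < q.1 < b) by apply: hE; rewrite mem_cat map_f.
  have e2 : ~~ (a < q.2 < b) by apply: hE; rewrite mem_cat map_f ?orbT.
  have qq := hL q qL; rewrite /overlap /inside /=.
  case: (ltP q.1 b) => h1b /=; last by rewrite !clamp_low ?subrr //; lra.
  have qa : q.1 <= a by rewrite leNgt; apply/negP => aq; rewrite aq h1b in e1.
  case: (leP b q.2) => h2b; first by rewrite !clamp_mid //; lra.
  have q2a : q.2 <= a by rewrite leNgt; apply/negP => aq; rewrite aq h2b in e2.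
  by rewrite !clamp_high ?subrr //; lra.
by rewrite -big_mkcond big_const_seq h1 /= ?addr0 // /inside /= ab lexx.
Qed.

End Overlap.

(** * Weights of partitions *)

Section Weight.
Variable R : realType.
Implicit Types (p q : R * R) (L : seq (R * R)) (x a b : R) (f g : R -> R).
Local Notation tau := (tau R).

Definition partition01 L :=
  (forall q, q \in L -> [/\ Ztau q.1, Ztau q.2, 0 <= q.1, q.1 < q.2 & q.2 <= 1]) /\
  (forall x, 0 < x <= 1 -> count (fun q => inside q x) L = 1%N).

Definition affine_on f q := exists (k : int) (c : R),
  Ztau c /\ forall x, inside q x -> f x = tau ^ k * x + c.

Definition chart f L := partition01 L /\ forall q, q \in L -> affine_on f q.

(** On an affine piece, the chord over the right half of (q.1, q.2] computes the
    slope; the left endpoint does not belong to the piece. *)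
Definition slope f q :=
  (f q.2 - f ((q.1 + q.2) / 2)) / (q.2 - (q.1 + q.2) / 2).

Definition intercept f q := f q.2 - slope f q * q.2.

Definition piece_weight f q :=
  pairing (slope f q * (q.2 - q.1)) (intercept f q).

Definition weight f L := \sum_(q <- L) piece_weight f q.

Lemma affine_data f q s c : q.1 < q.2 ->
  (forall x, inside q x -> f x = s * x + c) -> slope f q = s /\ intercept f q = c.
Proof.
move=> qq h.
suff e : slope f q = s.
  split=> //; rewrite /intercept e h; [ring|by rewrite /inside qq lexx].
rewrite /slope !h /inside; try (apply/andP; split; lra).
by field; rewrite -?mulr2n; apply/eqP; lra.
Qed.

Lemma piece_data f q : q.1 < q.2 -> affine_on f q ->
  [/\ exists k : int, slope f q = tau ^ k, Ztau (intercept f q) &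
      forall x, inside q x -> f x = slope f q * x + intercept f q].
Proof.
by move=> qq [k [c [hc h]]]; have [-> ->] := affine_data qq h; split=> //; exists k.
Qed.

(** Both weights are equal to the sum over all overlaps of a piece of L and a
    piece of L': on a nondegenerate overlap, f has a single slope and a single
    intercept. *)
Lemma chart_weight_uniq f L L' : chart f L -> chart f L' -> weight f L = weight f L'.
Proof.
have expand L1 L2 : chart f L1 -> chart f L2 -> weight f L1 =
    \sum_(q <- L1) \sum_(p <- L2) pairing (slope f q * overlap q p) (intercept f q).
  move=> [[h1 h2] h3] [[h4 h5] h6]; apply: eq_big_seq => q qL.
  have [z1 z2 q0 qq q1] := h1 q qL.
  have [[k hk] _ _] := piece_data qq (h3 q qL).
  rewrite -pairing_sum -?mulr_sumr ?overlap_sum ?(ltW qq) //.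
  - by move=> p /h4[_ _ _ /ltW].
  - by move=> x /andP[? ?]; apply: h5; apply/andP; split; lra.
  - move=> p /h4[? ? _ _ _]; rewrite hk; apply: ZtauM; first exact: ZtauX.
    by apply: ZtauB; exact: clamp_Ztau.
move=> hL hL'; rewrite (expand _ _ hL hL') (expand _ _ hL' hL) exchange_big /=.
apply: eq_big_seq => p pL'; apply: eq_big_seq => q qL.
have [_ _ _ qq _] := hL.1.1 q qL; have [_ _ _ pp _] := hL'.1.1 p pL'.
rewrite (overlapC (ltW pp) (ltW qq)).
have [->|/(overlap_gt0 qq pp) r0] := eqVneq (overlap q p) 0.
  by rewrite !mulr0 !pairing0l.
have [_ _ fq] := piece_data qq (hL.2 q qL).
have [_ _ fp] := piece_data pp (hL'.2 p pL').
have [||s1 i1] := @affine_data f (Num.max q.1 p.1, Num.min q.2 p.2)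
   (slope f q) (intercept f q) => //=.
  move=> x; rewrite /inside /= gt_max le_min => /andP[/andP[h1 _] /andP[h2 _]].
  by apply: fq; rewrite /inside h1.
have [||s2 i2] := @affine_data f (Num.max q.1 p.1, Num.min q.2 p.2)
   (slope f p) (intercept f p) => //=.
  move=> x; rewrite /inside /= gt_max le_min => /andP[/andP[_ h1] /andP[_ h2]].
  by apply: fp; rewrite /inside h1.
by rewrite -s1 -i1 s2 i2.
Qed.

(** Each point of s in turn cuts the interval that contains it in its interior. *)
Lemma partition_avoiding (s : seq R) : (forall e, e \in s -> Ztau e) ->
  exists L, partition01 L /\ forall q, q \in L -> forall e, e \in s -> ~~ (q.1 < e < q.2).
Proof.
elim: s => [_|e s ih hs].
  exists [:: (0, 1)]; split=> //; split=> [q|x hx /=]; last by rewrite /inside /= hx.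
  by rewrite inE => /eqP -> /=; split=> //; [exact: Ztau0|exact: Ztau1].
have [|L [[h1 h2] h3]] := ih; first by move=> r rs; apply: hs; rewrite inE rs orbT.
have he : Ztau e by apply: hs; rewrite mem_head.
pose cutp q := if q.1 < e < q.2 then [:: (q.1, e); (e, q.2)] else [:: q].
have cutpP q r : r \in cutp q -> q.1 <= r.1 /\ r.2 <= q.2.
  rewrite /cutp; case: ifP => [/andP[? ?]|_]; rewrite !inE; last by move=> /eqP ->.
  by case/orP => /eqP -> /=; split=> //; exact: ltW.
exists (flatten (map cutp L)); split; first split.
- move=> r /flatten_mapP[q /h1[z1 z2 q0 qq q1]]; rewrite /cutp; case: ifP; last first.
    by rewrite inE => _ /eqP ->.
  by move=> /andP[a1 a2]; rewrite !inE => /orP[] /eqP -> /=; split=> //; lra.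
- move=> x /h2 <-; rewrite count_flatten sumnE !big_map -sum1_count [RHS]big_mkcond.
  apply: eq_bigr => q _; rewrite /cutp; case: ifP => [/andP[a1 a2]|_] /=; rewrite ?addn0.
    by rewrite /inside /=; case: (ltP e x) => ? ; case: (ltP q.1 x) => ?;
      case: (leP x q.2) => ? //=; exfalso; lra.
  by case: inside.
- move=> r /flatten_mapP[q qL rq] d; have [b1 b2] := cutpP _ _ rq.
  rewrite inE => /predU1P[->|ds].
    move: rq; rewrite /cutp; case: ifP => [_|/negbT h]; rewrite !inE; last by move=> /eqP->.
    by case/orP => /eqP -> /=; rewrite ltxx ?andbF.
  by apply: contra (h3 q qL d ds) => /andP[? ?]; apply/andP; split; lra.
Qed.

Lemma Vtau_Ztau f x : is_Vtau f -> Ztau x -> Ztau (f x).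
Proof. by move=> /is_Vtau_ex[g [s [hb hs ha]]]; exact: aff_Ztau hb hs ha _. Qed.

Lemma affine_on_avoiding f s q : is_Vtau f -> affine_off f s ->
  Ztau q.2 -> 0 <= q.1 -> q.1 < q.2 -> q.2 <= 1 ->
  (forall e, e \in s -> ~~ (q.1 < e < q.2)) -> affine_on f q.
Proof.
move=> hf ha z2 q0 qq q1 hs; have [k [c h]] := ha q.1 q.2 q0 qq q1 hs.
exists k, c; split=> //.
have -> : c = f q.2 - tau ^ k * q.2 by rewrite h ?qq ?lexx //; ring.
by apply: ZtauB; [exact: Vtau_Ztau|apply: ZtauM => //; exact: ZtauX].
Qed.

(** The left endpoint is the limit of f from the right at q.1, which differs
    from f q.1 when f jumps there. *)
Definition image_itv f q := (slope f q * q.1 + intercept f q, f q.2).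

Lemma inside_image f q : q.1 < q.2 -> affine_on f q ->
  forall x, inside (image_itv f q) (slope f q * x + intercept f q) = inside q x.
Proof.
move=> qq hq x; have [[k hk] _ h] := piece_data qq hq.
have s0 : 0 < slope f q by rewrite hk tauX_gt0.
by rewrite /inside /image_itv /= h ?ltrD2r ?lerD2r ?ltr_pM2l ?ler_pM2l // /inside qq lexx.
Qed.

(** A point y lies in the image of the piece that contains its preimage under f,
    and in no other. *)
Lemma partition_image f L : is_Vtau f -> chart f L -> partition01 (map (image_itv f) L).
Proof.
move=> hf [[hL1 hL2] hL3]; have [g [s [[fg gf hI _] _ _]]] := is_Vtau_ex hf.
split=> [r /mapP[q qL ->]|y hy].
  have [z1 z2 q0 qq q1] := hL1 q qL.
  have [[k hk] zi h] := piece_data qq (hL3 q qL).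
  have s0 : 0 < slope f q by rewrite hk tauX_gt0.
  have /andP[_ f1] : 0 < f q.2 <= 1 by rewrite hI; apply/andP; split; lra.
  split=> /=.
  - by apply: ZtauD => //; apply: ZtauM => //; rewrite hk; exact: ZtauX.
  - exact: Vtau_Ztau.
  - rewrite hk; apply: (left_end_ge0 qq) => x hx; rewrite -hk -h //.
    have : 0 < f x <= 1 by rewrite hI; case/andP: hx => *; apply/andP; split; lra.
    by case/andP.
  - by rewrite h ?ltrD2r ?ltr_pM2l // /inside qq lexx.
  - by [].
rewrite -(hL2 (g y)); last by rewrite -hI gf.
rewrite count_map; apply: eq_in_count => q qL /=.
have [_ _ _ qq _] := hL1 q qL; have hq := hL3 q qL.
have [[k hk] _ h] := piece_data qq hq.
have s0 : slope f q != 0 by rewrite hk gt_eqF ?tauX_gt0.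
have -> : y = slope f q * ((y - intercept f q) / slope f q) + intercept f q.
  by rewrite mulrC divfK // subrK.
rewrite inside_image //; set x := (y - _) / _.
have hx : y = slope f q * x + intercept f q by rewrite /x mulrC divfK // subrK.
rewrite -hx; apply/idP/idP => hin; first by rewrite hx -h // fg.
suff -> : x = g y by [].
by apply: (mulfI s0); apply: (@addIr _ (intercept f q)); rewrite -hx -h // gf.
Qed.

(** The identity B(s' s l, s' c + c') = B(s' s l, c') + B(s l, c), summed over the
    pieces. *)
Lemma chart_comp f g L : is_Vtau f -> chart f L ->
  (forall q, q \in L -> affine_on g (image_itv f q)) ->
  chart (g \o f) L /\
  weight (g \o f) L = weight g (map (image_itv f) L) + weight f L.
Proof.
move=> hf hL hg; have [[hL1 hL2] hL3] := hL; have hi := partition_image hf hL.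
have piece q : q \in L -> affine_on (g \o f) q /\ piece_weight (g \o f) q =
    piece_weight g (image_itv f q) + piece_weight f q.
  move=> qL; have [z1 z2 _ qq _] := hL1 q qL.
  have [_ _ _ ii _] := hi.1 _ (map_f _ qL).
  have [[k hk] zc h] := piece_data qq (hL3 q qL).
  have [[k' hk'] zc' h'] := piece_data ii (hg q qL).
  have e x : inside q x -> (g \o f) x = (slope g (image_itv f q) * slope f q) * x +
      (slope g (image_itv f q) * intercept f q + intercept g (image_itv f q)).
    by move=> hx /=; rewrite h // h' ?inside_image ?mulrDr ?mulrA ?addrA //; exact: hL3.
  split.
    exists (k' + k), (slope g (image_itv f q) * intercept f q + intercept g (image_itv f q)).
    split; last by move=> x /e ->; rewrite hk hk' expfzDr ?gt_eqF ?tau_gt0.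
    by apply: ZtauD => //; apply: ZtauM => //; rewrite hk'; exact: ZtauX.
  have [es ei] := affine_data qq e.
  rewrite /piece_weight es ei -mulrA.
  have -> : (image_itv f q).2 - (image_itv f q).1 = slope f q * (q.2 - q.1).
    by rewrite /image_itv /= h /inside ?qq ?lexx //; ring.
  have zl : Ztau (slope f q * (q.2 - q.1)).
    by apply: ZtauM; [rewrite hk; exact: ZtauX|exact: ZtauB].
  have zx y : Ztau y -> Ztau (tau ^ k' * y) by move=> ?; apply: ZtauM => //; exact: ZtauX.
  by rewrite hk' pairingDr //; [rewrite pairingX // addrC|exact: zx].
split; first by split=> // q /piece[].
by rewrite /weight big_map -big_split; apply: eq_big_seq => q /piece[].
Qed.

End Weight.

(** * The parity homomorphism *)

Section Parity.
Variable R : realType.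

Definition some_chart (f : R -> R) := xget [::] [set L | chart f L].

Definition parity (f : Vtau R) : 'Z_2 := weight f (some_chart f).

Lemma parityE (f : Vtau R) L : chart f L -> parity f = weight f L.
Proof.
move=> hL; apply: chart_weight_uniq => //.
exact: (xgetPex [::] (ex_intro (chart f) L hL)).
Qed.

(** The partition for f avoids the breakpoints of f and the preimages of those of
    g, so that g is affine on the images of its intervals. *)
Lemma parityM : {morph parity : f g / (f * g)%g >-> f + g}.
Proof.
move=> g f.
have [hg hf] := (VtauP g, VtauP f).
have [s [hs ha]] := affP hf; have [s' [hs' ha']] := affP hg.
have hfi := VtauP f^-1%g.
have [|L [hL hLs]] := @partition_avoiding _ (s ++ map f^-1%g s').
  by move=> e; rewrite mem_cat => /orP[/hs//|/mapP[d /hs' zd ->]]; exact: Vtau_Ztau.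
have hLf : chart f L.
  split=> // q qL; have [z1 z2 q0 qq q1] := hL.1 q qL.
  apply: (affine_on_avoiding hf ha) => // e es; apply: hLs => //.
  by rewrite mem_cat es.
have hi := partition_image hf hLf.
have hgi q : q \in L -> affine_on g (image_itv f q).
  move=> qL; have [_ _ _ qq _] := hL.1 q qL.
  have [y1 y2 i0 ii i1] := hi.1 _ (map_f _ qL).
  apply: (affine_on_avoiding hg ha') => // e es'; apply/negP => /andP[e1 e2].
  have [[k hk] _ h] := piece_data qq (hLf.2 q qL).
  have s0 : 0 < slope f q by rewrite hk tauX_gt0.
  set x := (e - intercept f q) / slope f q.
  have hx : e = slope f q * x + intercept f q by rewrite /x mulrC divfK ?subrK ?gt_eqF.
  have xq : q.1 < x < q.2.
    move: e1 e2; rewrite hx /image_itv /= h /inside ?qq ?lexx //.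
    by rewrite !ltrD2r !ltr_pM2l // => -> ->.
  have fx : f^-1%g e = x.
    by rewrite hx -h ?Vtau_funK // /inside; case/andP: xq => -> /ltW.
  have hin : f^-1%g e \in s ++ map f^-1%g s' by rewrite mem_cat map_f ?orbT.
  by have := hLs q qL _ hin; rewrite fx xq.
have [hgf e] := chart_comp hf hLf hgi.
rewrite (@parityE (g * f)%g L hgf) (parityE hLf) -(@parityE g (map (image_itv f) L)) in e *.
  exact: e.
by split=> // r /mapP[q qL ->]; exact: hgi.
Qed.

End Parity.

(** * Parity of tree pairs *)

Fixpoint ycarets (t : tree) : 'Z_2 :=
  if t is Node c l r then
    (if c is ycaret then 1 else 0) + ycarets l + ycarets r
  else 0.

Section TreeParity.
Variable R : realType.
Local Notation tau := (tau R).

(** The contribution of a leaf, as source or as target, to the parity of a tree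
    pair. *)
Definition itv_weight (q : R * R) : 'Z_2 := pairing (q.2 - q.1) q.1.

(** If l and r are the lengths of the left and right parts, biadditivity leaves
    the term B(r, l).  Up to a common power of tau, (r, l) is (1, tau) for an
    x-caret and (tau, 1) for a y-caret. *)
Lemma itv_weight_cut c (a b : R) (k : int) : Ztau a -> b - a = tau ^ k ->
  itv_weight (a, Defs.cut c a b) + itv_weight (Defs.cut c a b, b) =
  itv_weight (a, b) + (if c is ycaret then 1 else 0).
Proof.
move=> za hk; rewrite /itv_weight /=; set m := Defs.cut c a b.
have zk := ZtauX R k; have z1 := Ztau1 R; have zt := Ztau_tau R.
have zM x y := @ZtauM R x y.
have zl : Ztau (m - a).
  by rewrite /m /Defs.cut addrC addKr hk; case: (c); rewrite ?expr1 ?expr2; auto.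
have zr : Ztau (b - m).
  have -> : b - m = (b - a) - (m - a) by ring.
  by rewrite hk; exact: ZtauB.
have -> : pairing (b - a) a = pairing (m - a) a + pairing (b - m) a.
  by rewrite -pairingDl //; congr pairing; ring.
have -> : pairing (b - m) m = pairing (b - m) a + pairing (b - m) (m - a).
  by rewrite -pairingDr //; congr pairing; ring.
rewrite [LHS]addrA; congr (_ + _); have := tau_sqr R => e2; have [p1 p2] := pairing_1tau R.
case: c @m zl zr => m zl zr.
  have -> : b - m = tau ^ k * (tau * 1).
    by rewrite /m /Defs.cut hk mulr1 -[X in X - _](subrK a) hk e2; ring.
  have -> : m - a = tau ^ k * (tau * tau) by rewrite /m /Defs.cut hk expr2; ring.
  by rewrite pairingX ?pairing_tau ?p1 //; do ?apply: zM.
have -> : b - m = tau ^ k * (tau * tau).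
  by rewrite /m /Defs.cut hk -[X in X - _](subrK a) hk -expr2 e2; ring.
have -> : m - a = tau ^ k * (tau * 1) by rewrite /m /Defs.cut hk mulr1 expr1; ring.
by rewrite pairingX ?pairing_tau ?p2 //; do ?apply: zM.
Qed.

Lemma sum_itv_weight (t : tree) (a b : R) (k : int) :
  Ztau a -> b - a = tau ^ k ->
  \sum_(q <- leaves t a b) itv_weight q = itv_weight (a, b) + ycarets t.
Proof.
elim: t a b k => [|c l hl r hr] a b k za hk /=; first by rewrite big_seq1 addr0.
have ab : a < b by rewrite -subr_gt0 hk tauX_gt0.
have [_ [i [j [ei ej]]]] := cutP c ab.
have zm : Ztau (Defs.cut c a b).
  have -> : Defs.cut c a b = (Defs.cut c a b - a) + a by ring.
  by apply: ZtauD => //; rewrite ei hk; apply: ZtauM; exact: ZtauX.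
rewrite hk -expfzDr ?gt_eqF ?tau_gt0 // in ei.
rewrite hk -expfzDr ?gt_eqF ?tau_gt0 // in ej.
rewrite big_cat /= (hl _ _ _ za ei) (hr _ _ _ zm ej).
by rewrite addrACA (itv_weight_cut c za hk) !addrA.
Qed.

(** A leaf (u, u + tau^i] is sent onto a leaf (u', u' + tau^j] by a map of slope
    tau^(j - i) and intercept u' - tau^(j - i) u; invariance turns the term
    B(tau^j, tau^(j - i) u) into B(tau^i, u). *)
Lemma tree_fun_affine k (T1 T2 : tree) (p : 'S_k) (h1 : nleaves T1 = k)
  (h2 : nleaves T2 = k) (i : 'I_k) :
  affine_on (tree_fun T1 p T2) (leaf R T2 i) /\
  piece_weight (tree_fun T1 p T2) (leaf R T2 i) =
    itv_weight (leaf R T1 (p i)) + itv_weight (leaf R T2 i).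
Proof.
have [|_ l1 _ [k1 e1]] := @leafP R T1 (p i); first by rewrite h1.
have [|_ l2 _ [k2 e2]] := @leafP R T2 i; first by rewrite h2.
have zz (T : tree) (j : 'I_k) : nleaves T = k -> Ztau (leaf R T j).1.
  move=> hT; have [|//] := @leaves_Ztau R T 0 1 j (Ztau0 R) (Ztau1 R).
  by rewrite hT.
have z1 := zz T1 (p i) h1; have z2 := zz T2 i h2.
set q := leaf R T2 i in l2 e2 z2 *; set r := leaf R T1 (p i) in l1 e1 z1 *.
have h x : inside q x -> tree_fun T1 p T2 x =
    tau ^ (k1 - k2) * x + (r.1 - tau ^ (k1 - k2) * q.1).
  move=> hx; rewrite (tree_fun_in T1 p h2 hx) -/q -/r e1 e2.
  by rewrite expfzDr ?gt_eqF ?tau_gt0 // -invr_expz; ring.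
have zd : Ztau (tau ^ (k1 - k2) * q.1) by apply: ZtauM => //; exact: ZtauX.
split.
  by exists (k1 - k2), (r.1 - tau ^ (k1 - k2) * q.1); split=> //; exact: ZtauB.
have [es ei] := affine_data l2 h.
rewrite /piece_weight es ei /itv_weight e1 e2.
rewrite pairingDr //; last exact: ZtauN.
rewrite pairingNr // pairingX //; last exact: ZtauX.
by rewrite -expfzDr ?gt_eqF ?tau_gt0 // subrK.
Qed.

Lemma partition_leaves (t : tree) : partition01 (leaves t 0 1 : seq (R * R)).
Proof.
split=> [q /(nthP (0, 0))[i hi <-]|x hx].
  rewrite size_leaves in hi; have [l0 l1 l2 _] := leafP R hi.
  by have [|y1 y2] := @leaves_Ztau R t 0 1 i (Ztau0 R) (Ztau1 R).
have [i hi hxi] := leaves_cover t ltr01 hx.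
rewrite -(mkseq_nth (0, 0) (leaves t 0 1)) count_map size_leaves.
rewrite (@eq_in_count _ _ (pred1 i)).
  by rewrite count_uniq_mem ?iota_uniq // mem_iota hi.
move=> j; rewrite mem_iota /= => hj; apply/idP/eqP => [hxj|->//].
exact: (leaf_uniq hj hi hxj hxi).
Qed.

Lemma parity_tree_elt k (T1 T2 : tree) (h1 : nleaves T1 = k)
  (h2 : nleaves T2 = k) (p : 'S_k) :
  parity (tree_elt R h1 h2 p) = ycarets T1 + ycarets T2.
Proof.
have [hp0 hp1] := partition_leaves T2.
have hidx q : q \in leaves T2 0 1 -> exists i : 'I_k, q = leaf R T2 i.
  move=> /(nthP (0, 0))[i hi <-]; rewrite size_leaves h2 in hi.
  by exists (Ordinal hi).
have hc : chart (tree_elt R h1 h2 p) (leaves T2 0 1).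
  split=> // q /hidx[i ->]; exact: (tree_fun_affine p h1 h2 i).1.
rewrite (parityE hc) /weight.
have sumE (T : tree) (F : R * R -> 'Z_2) : nleaves T = k ->
    \sum_(q <- leaves T 0 1) F q = \sum_(i < k) F (leaf R T i).
  by move=> hT; rewrite (big_nth (0, 0)) size_leaves hT big_mkord.
rewrite sumE //.
transitivity (\sum_(i < k) (itv_weight (leaf R T1 (p i)) + itv_weight (leaf R T2 i))).
  by apply: eq_bigr => i _; exact: (tree_fun_affine p h1 h2 i).2.
have -> : \sum_(i < k) (itv_weight (leaf R T1 (p i)) + itv_weight (leaf R T2 i)) =
    \sum_(i < k) itv_weight (leaf R T1 i) + \sum_(i < k) itv_weight (leaf R T2 i).
  by rewrite big_split /= [in RHS](reindex_inj (@perm_inj _ p)).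
rewrite -!sumE // !(@sum_itv_weight _ _ _ 0) ?subr0 //; try exact: Ztau0.
by rewrite addrACA Z2_addxx add0r.
Qed.

Lemma ycarets_spine m : ycarets (spine m) = 0.
Proof. by elim: m => //= m ->; rewrite !addr0. Qed.

Lemma ycarets_attach t i t' : (i < nleaves t)%N ->
  ycarets (attach t i t') = ycarets t + ycarets t'.
Proof.
elim: t i => [|c l hl r hr] i /=; first by rewrite ltnS leqn0 add0r => ->.
move=> hi; case: ltnP => h /=; first by rewrite hl //; ring.
by rewrite hr ?ltn_subLR //; ring.
Qed.

Lemma ycarets_spine_with c n :
  ycarets (spine_with c n) = if c is ycaret then 1 else 0.
Proof.
rewrite /spine_with ycarets_attach ?nleaves_spine // ycarets_spine /=.
by rewrite !addr0 add0r.
Qed.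

End TreeParity.

(** * Homeomorphisms of the circle *)

Section CircleMaps.
Variable R : realType.
Implicit Types (s t x y : R) (m n : int) (u v : @unit_itv R).

Lemma unit_itvP u : 0 <= val u <= 1.
Proof. by have := valP u; rewrite inE /unit_itv /= in_itv. Qed.

Lemma unit_itv_ex x : 0 <= x <= 1 -> exists u, val u = x.
Proof.
move=> hx; have h : x \in @unit_itv R by rewrite inE /unit_itv /= in_itv.
by exists (exist _ x h).
Qed.

(** The fundamental domain (0,1], rather than [0,1), is the domain of the elements
    of V_tau. *)
Lemma int_shift t : exists x n, 0 < x <= 1 /\ t = x + n%:~R.
Proof.
exists (t - (Num.ceil t - 1)%:~R), (Num.ceil t - 1).
rewrite subrK; split=> //; have := ceil_itv t; rewrite !rmorphB /=.
by move=> /andP[? ?]; apply/andP; split; lra.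
Qed.

Lemma circle_cover_shift u n t : t = val u + n%:~R -> circle_cover t = circle_pt u.
Proof.
move=> ->; have /andP[u0] := unit_itvP u; rewrite le_eqVlt => /predU1P[u1|u1].
  apply/eqmodP; rewrite /=; apply/orP; right; rewrite /is_end /= u1 eqxx orbT andbT.
  have -> : Num.floor (1 + n%:~R : R) = n + 1.
    by apply: floor_def; rewrite !rmorphD /=; apply/andP; split; lra.
  by rewrite rmorphD /= [1 + _]addrC subrr eqxx.
congr circle_pt; apply: val_inj => /=.
have -> : Num.floor (val u + n%:~R : R) = n.
  by apply: floor_def; rewrite rmorphD /= lerDr (addrC n%:~R) ltrD2r u1 andbT.
by rewrite addrK.
Qed.

Lemma circle_cover_val u : circle_cover (val u) = circle_pt u.
Proof. by apply: (@circle_cover_shift u 0); rewrite addr0. Qed.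

Lemma circle_coverD t n : circle_cover (t + n%:~R) = circle_cover t.
Proof.
have [x [m [/andP[x0 x1] ->]]] := int_shift t.
have [|u hu] := @unit_itv_ex x; first by rewrite x1 ltW.
transitivity (circle_pt u); last by apply/esym/(@circle_cover_shift u m); rewrite hu.
by apply: (@circle_cover_shift u (m + n)); rewrite hu rmorphD /= addrA.
Qed.

Lemma circle_cover_surj (z : circle R) : exists t, circle_cover t = z.
Proof. by elim/quotW: z => u; exists (val u); exact: circle_cover_val. Qed.

Lemma circle_cover_eq s t : circle_cover s = circle_cover t ->
  exists n, s = t + n%:~R.
Proof.
move/eqmodP; rewrite /= => /orP[/eqP/(congr1 val) /= h|].
  exists (Num.floor s - Num.floor t); rewrite rmorphB /=; lra.
rewrite /is_end /= => /andP[hs ht].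
have int_end (w : R) : (w - (Num.floor w)%:~R == 0) || (w - (Num.floor w)%:~R == 1) ->
    exists n, w = n%:~R.
  case/orP => /eqP h; first by exists (Num.floor w); lra.
  by exists (Num.floor w + 1); rewrite rmorphD /=; lra.
have [i ->] := int_end s hs; have [j ->] := int_end t ht.
by exists (i - j); rewrite rmorphB /=; ring.
Qed.

(** At a point t that is not an integer, the nearby points lift to [0,1] by the
    translation that lifts t.  At an integer, the points to the left lift near 1
    and those to the right near 0, and an open set of the circle that contains
    the class of t contains the images of both. *)
Lemma circle_cover_continuous : continuous (@circle_cover R).
Proof.
apply/continuousP => A [V oV hV]; rewrite openE => t At.
have inV u : A (circle_pt u) = V (val u).
  exact: (esym (congr1 (fun B : set (@unit_itv R) => B u) hV)).
have near_shift n x : t = x + n%:~R -> V x -> \forall s \near t, V (s - n%:~R).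
  move=> ht Vx; have : s - n%:~R @[s --> t] --> x.
    have -> : x = t - n%:~R by rewrite ht addrK.
    by apply: cvgB; [exact: cvg_id|exact: cvg_cst].
  by apply; exact: open_nbhs_nbhs.
have coverA s n : 0 <= s - n%:~R <= 1 -> V (s - n%:~R) -> A (circle_cover s).
  move=> /unit_itv_ex[u hu]; rewrite -hu -inV -(@circle_cover_shift u n s) //.
  by rewrite hu subrK.
have coverV x n : 0 <= x <= 1 -> t = x + n%:~R -> V x.
  by move=> /unit_itv_ex[u <-] /circle_cover_shift ht; rewrite -inV -ht.
have [x [n [/andP[x0 x1] ht]]] := int_shift t.
have Vx : V x by apply: (@coverV x n) => //; rewrite x1 ltW.
have nx := near_shift _ _ ht Vx.
have [x1'|x1'] := eqVneq x 1; last first.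
  have {}x1 : x < 1 by rewrite lt_neqAle x1'.
  rewrite /interior /=; near=> s; apply: (@coverA s n); last by near: s.
  have s1 : n%:~R < s by near: s; apply: lt_nbhsr; rewrite ht ltrDr.
  have s2 : s < 1 + n%:~R by near: s; apply: lt_nbhsl; rewrite ht ltrD2r.
  by apply/andP; split; lra.
(* t = 1 + n = 0 + (n + 1): V contains both lifts of the class of t. *)
have V0 : V 0 by apply: (@coverV 0 (n + 1)); rewrite ?lexx ?ler01 // ht x1' rmorphD /=; ring.
have n0 : \forall s \near t, V (s - (n + 1)%:~R).
  by apply: near_shift V0; rewrite ht x1' rmorphD /=; ring.
rewrite /interior /=; near=> s.
have s1 : n%:~R < s by near: s; apply: lt_nbhsr; rewrite ht ltrDr.
have s2 : s < 2 + n%:~R by near: s; apply: lt_nbhsl; rewrite ht ltrD2r; lra.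
have [st|st] := leP s t.
  apply: (@coverA s n); last by near: s.
  by apply/andP; split; lra.
apply: (@coverA s (n + 1)); last by near: s.
by rewrite rmorphD /=; apply/andP; split; lra.
Unshelve. all: by end_near.
Qed.

Lemma circle_map_of_lift (F : R -> R) : continuous F ->
  (forall t n, F (t + n%:~R) = F t + n%:~R) ->
  exists2 phi : circle R -> circle R, continuous phi &
    forall t, phi (circle_cover t) = circle_cover (F t).
Proof.
move=> cF hF; have [lift hlift] := choice circle_cover_surj.
pose phi z := circle_cover (F (lift z)).
have hphi t : phi (circle_cover t) = circle_cover (F t).
  have [n e] := circle_cover_eq (hlift (circle_cover t)).
  by rewrite /phi e hF circle_coverD.
exists phi => //; apply/quotient_continuous.
have -> : phi \o \pi_(quotient_topology (circle R))%qT =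
    @circle_cover R \o (F \o (set_val : @unit_itv R -> R)).
  by apply/funext => u /=; rewrite -hphi circle_cover_val.
move=> u; apply: continuous_comp; last exact: circle_cover_continuous.
by apply: continuous_comp; [exact: initial_continuous|exact: cF].
Qed.

Lemma increasing_cancel_continuous (F G : R -> R) : cancel G F ->
  {homo F : s t / s < t} -> {homo G : s t / s < t} -> continuous F.
Proof.
move=> GF hF hG t; apply/cvgrPdist_lt => eps e0.
near=> s.
have s1 : G (F t - eps) < s.
  near: s; apply: lt_nbhsr; rewrite ltNge; apply/negP; rewrite le_eqVlt => /predU1P[h|/hF].
    by have := GF (F t - eps); rewrite -h; lra.
  by rewrite GF; lra.
have s2 : s < G (F t + eps).
  near: s; apply: lt_nbhsl; rewrite ltNge; apply/negP; rewrite le_eqVlt => /predU1P[h|/hF].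
    by have := GF (F t + eps); rewrite h; lra.
  by rewrite GF; lra.
have := hF _ _ s1; have := hF _ _ s2; rewrite !GF => h1 h2.
by rewrite ltr_norml; apply/andP; split; lra.
Unshelve. all: by end_near.
Qed.

(** The hypothesis says that f, corrected by the integers e, is increasing on
    (0,1] with an oscillation smaller than 1.  Its extension F that commutes with
    integer translations is then increasing on the line, and it is onto because f
    is onto (0,1]. *)
Lemma is_Ttau_cyclic (f : Vtau R) (e : R -> int) :
  (forall x y, 0 < x -> x < y -> y <= 1 ->
     f x + (e x)%:~R < f y + (e y)%:~R < f x + (e x)%:~R + 1) ->
  is_Ttau f.
Proof.
move=> he.
have fI x : (0 < f x <= 1) = (0 < x <= 1).
  have [g [s [[_ _ hI _] _ _]]] := is_Vtau_ex (VtauP f); exact: hI.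
pose F t := f (t - (Num.ceil t - 1)%:~R) +
            (e (t - (Num.ceil t - 1)%:~R))%:~R + (Num.ceil t - 1)%:~R.
have FE x n : 0 < x <= 1 -> F (x + n%:~R) = f x + (e x)%:~R + n%:~R.
  move=> /andP[x0 x1]; rewrite /F.
  have -> : Num.ceil (x + n%:~R) - 1 = n.
    by rewrite (@ceil_def _ _ (n + 1)) ?addrK // rmorphD /=; apply/andP; split; lra.
  by rewrite addrK.
have FD t n : F (t + n%:~R) = F t + n%:~R.
  have [x [m [hx ->]]] := int_shift t.
  by rewrite -addrA -rmorphD /= !FE // rmorphD /= !addrA.
have Finc : {homo F : s t / s < t}.
  move=> s t; have [x [n [hx ->]]] := int_shift s; have [y [m [hy ->]]] := int_shift t.
  rewrite !FE // => st; case/andP: (hx) => x0 x1; case/andP: (hy) => y0 y1.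
  have : n <= m.
    by rewrite -ltzD1 -(ltr_int R) rmorphD /=; lra.
  rewrite le_eqVlt => /predU1P[nm|].
    by move: st; rewrite nm !ltrD2r => xy; have /andP[] := he x y x0 xy y1.
  rewrite -lezD1 -(ler_int R) rmorphD /= => nm.
  have [xy|yx|->] := ltgtP x y; last by lra.
    by have /andP[] := he x y x0 xy y1; lra.
  by have /andP[] := he y x y0 yx x1; lra.
have Fsurj z : exists t, F t = z.
  have [y [n [hy ->]]] := int_shift z.
  have [w fw] : exists w, f w = y by exists (f^-1%g y); exact: Vtau_invK.
  have hw : 0 < w <= 1 by rewrite -fI fw.
  by exists (w + (n - e w)%:~R); rewrite (FE _ _ hw) fw rmorphB /=; ring.
have [G GF] := choice Fsurj.
have Finj : injective F.
  move=> s t h; have [/Finc|/Finc|//] := ltgtP s t; by rewrite h ltxx.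
have FG : cancel F G by move=> t; apply: Finj; rewrite GF.
have Ginc : {homo G : s t / s < t}.
  move=> s t st; rewrite ltNge; apply/negP; rewrite le_eqVlt => /predU1P[h|/Finc].
    by move: st; rewrite -(GF s) -(GF t) h ltxx.
  by rewrite !GF; lra.
have GD t n : G (t + n%:~R) = G t + n%:~R by apply: Finj; rewrite FD !GF.
have cF := increasing_cancel_continuous GF Finc Ginc.
have cG := increasing_cancel_continuous FG Ginc Finc.
have [phi cphi hphi] := circle_map_of_lift cF FD.
have [psi cpsi hpsi] := circle_map_of_lift cG GD.
exists phi; split.
- move=> u v u0 hv; rewrite -!circle_cover_val hphi hv.
  have -> : F (val u) = F (val u + 0%:~R) by rewrite addr0.
  rewrite FE; last by have /andP[_ ->] := unit_itvP u; rewrite u0.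
  by rewrite addr0 circle_coverD.
- exists psi; split=> // z; have [t <-] := circle_cover_surj z.
    by rewrite hphi hpsi FG.
  by rewrite hpsi hphi GF.
- by exists F, G.
Qed.

(** * Cyclic tree pairs *)

(** The leaves in c are an initial segment that p moves behind all the other
    leaves, keeping the order inside both groups; lowering f by 1 on these leaves
    makes it increasing. *)
Lemma tree_elt_Ttau k (T1 T2 : tree) (h1 : nleaves T1 = k) (h2 : nleaves T2 = k)
  (p : 'S_k) (c : pred 'I_k) :
  (forall i j : 'I_k, (i < j)%N -> (c j ==> c i) && ((p j < p i)%N == c i && ~~ c j)) ->
  is_Ttau (tree_elt R h1 h2 p).
Proof.
move=> hc; pose f : R -> R := tree_fun T1 p T2.
have f_lt (i j : 'I_k) x y : (leaf R T2 i).1 < x <= (leaf R T2 i).2 ->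
    (leaf R T2 j).1 < y <= (leaf R T2 j).2 -> (p i < p j)%N -> f x < f y.
  move=> /(tree_fun_image p h1 h2)/andP[_ xi] /(tree_fun_image p h1 h2)/andP[yj _] ij.
  have h : (leaf R T1 (p i)).2 <= (leaf R T1 (p j)).1.
    by apply: leaves_sorted => //; rewrite h1.
  exact: le_lt_trans xi (le_lt_trans h yj).
have f_incr (i : 'I_k) x y : (leaf R T2 i).1 < x <= (leaf R T2 i).2 ->
    (leaf R T2 i).1 < y <= (leaf R T2 i).2 -> x < y -> f x < f y.
  move=> xi yi xy; rewrite /f (tree_fun_in T1 p h2 xi) (tree_fun_in T1 p h2 yi).
  have [|_ l1 _ _] := @leafP R T1 (p i); first by rewrite h1.
  have [|_ l2 _ _] := @leafP R T2 i; first by rewrite h2.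
  by rewrite ltrD2l ltr_pM2l ?ltrD2r // divr_gt0 ?subr_gt0.
pose e x : int := if [exists i, c i && ((leaf R T2 i).1 < x <= (leaf R T2 i).2)]
  then -1 else 0.
have eE (i : 'I_k) x : (leaf R T2 i).1 < x <= (leaf R T2 i).2 ->
    e x = if c i then -1 else 0.
  move=> xi; rewrite /e; case: existsP => [[j /andP[cj xj]]|h].
    have ij : i = j by apply/ord_inj/(leaf_uniq _ _ xi xj); rewrite h2.
    by rewrite ij cj.
  by case: ifP => // ci; case: h; exists i; rewrite ci.
apply: (@is_Ttau_cyclic _ e) => x y x0 xy y1 /=; rewrite -/f.
have hx : 0 < x <= 1 by apply/andP; split; lra.
have hy : 0 < y <= 1 by apply/andP; split; lra.
have /andP[fx0 fx1] : 0 < f x <= 1 by exact: tree_fun_I.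
have /andP[fy0 fy1] : 0 < f y <= 1 by exact: tree_fun_I.
have [i xi] := tree_fun_ex h2 hx; have [j yj] := tree_fun_ex h2 hy.
rewrite (eE i x xi) (eE j y yj).
have [ij|ji|ij] := ltngtP i j.
- have /andP[cji /eqP] := hc i j ij.
  case ci: (c i); case cj: (c j) => /= hp.
  + have pij : (p i < p j)%N.
      by rewrite ltn_neqAle leqNgt hp andbT (inj_eq val_inj) (inj_eq perm_inj) neq_ltn ij.
    by have := f_lt i j x y xi yj pij; rewrite rmorphN rmorph1 => ?; apply/andP; split; lra.
  + by have := f_lt j i y x yj xi hp; rewrite rmorphN rmorph1 => ?; apply/andP; split; lra.
  + by rewrite ci cj in cji.
  + have pij : (p i < p j)%N.
      by rewrite ltn_neqAle leqNgt hp andbT (inj_eq val_inj) (inj_eq perm_inj) neq_ltn ij.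
    by have := f_lt i j x y xi yj pij => ?; apply/andP; split; lra.
- have h : (leaf R T2 j).2 <= (leaf R T2 i).1.
    by apply: leaves_sorted => //; rewrite h2.
  suff : x < x by rewrite ltxx.
  by case/andP: xi => ? _; case/andP: yj => _ ?; lra.
- move: yj; rewrite -(ord_inj ij) => yi; have := f_incr i x y xi yi xy.
  by case: (c i); rewrite ?rmorphN ?rmorph1 => ?; apply/andP; split; lra.
Qed.

Lemma tree_elt1_Ttau k (T1 T2 : tree) (h1 : nleaves T1 = k) (h2 : nleaves T2 = k) :
  is_Ttau (tree_elt R h1 h2 1%g).
Proof.
apply: (@tree_elt_Ttau _ _ _ _ _ _ (fun=> false)) => i j ij /=.
by rewrite !perm1 ltnNge ltnW.
Qed.

Lemma c_gen_Ttau (n : nat) : is_Ttau (c_gen R n).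
Proof.
apply: (@tree_elt_Ttau _ _ _ _ _ _ (fun i => i == ord0)) => i j ij.
have ordE (a : 'I_n.+2) : (ord_pred a : nat) = if a == ord0 then n.+1 else a.-1.
  rewrite /=; have [->|] := eqVneq a ord0; first by rewrite /= modn_small.
  rewrite -val_eqE -lt0n /= => a0; rewrite -(prednK a0) addSn /= modnDr modn_small //.
  by rewrite (leq_ltn_trans (leq_pred _)).
rewrite !permE !ordE.
have j0 : (j == ord0) = false by rewrite -val_eqE /=; apply/gtn_eqF/(leq_ltn_trans _ ij).
rewrite j0 /=; have [_|i0] := eqVneq i ord0 => /=.
  by rewrite eqb_id prednK ?(leq_ltn_trans _ ij) // -ltnS.
by rewrite eqbF_neg -leqNgt -!subn1 leq_sub2r // ltnW.
Qed.

End CircleMaps.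

(** * The subgroups of index two *)

(** The cosets of the kernel are the fibres of phi. *)
Lemma kernel_index2 (G : groupType) (phi : G -> 'Z_2) :
  {morph phi : f g / (f * g)%g >-> f + g} -> (forall z, exists f, phi f = z) ->
  normal_of_index (fun f => phi f == 0) 2.
Proof.
move=> phiM phi_surj; set N : {pred G} := fun f => phi f == 0.
have NE f : (f \in N) = (phi f == 0) by [].
have phi1 : phi 1%g = 0 by apply: (@addrI _ (phi 1%g)); rewrite -phiM mulg1 addr0.
have phiV f : phi f^-1%g = phi f.
  by apply: (@addrI _ (phi f)); rewrite -phiM mulgV phi1 Z2_addxx.
have cosetE g : [set h | (g^-1 * h)%g \in N] = [set h | phi h = phi g].
  apply/seteqP; split=> h; rewrite /= NE phiM phiV.
    by move/eqP => e; apply: (@addrI _ (phi g)); rewrite e Z2_addxx.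
  by move=> ->; rewrite Z2_addxx.
split.
- split; first by rewrite NE phi1.
  by move=> f g; rewrite !NE phiM phiV => /eqP -> /eqP ->.
- move=> g h; rewrite !NE => /eqP h0.
  by rewrite conjgE !phiM phiV h0 add0r Z2_addxx.
pose fib (z : 'Z_2) := [set h | phi h = z].
have -> : lcosets_of N = fib @` setT.
  apply/seteqP; split=> C.
    by move=> [g ->]; exists (phi g) => //; rewrite cosetE.
  by move=> [z _ <-]; have [g <-] := phi_surj z; exists g; rewrite cosetE.
have fib_inj : {in setT &, injective fib}.
  move=> z w _ _ h; have [f hf] := phi_surj z.
  by have := congr1 (fun A => A f) h; rewrite /fib /= hf => <-.
apply: card_eq_trans (inj_card_eq fib_inj) _.
by rewrite card_eq_sym; exact: (@card_II 2).
Qed.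

Theorem mainTheorem3 (R : realType) :
  (exists phi : Ttau R -> 'Z_2,
     {morph phi : f g / (f * g)%g >-> f + g} /\
     (forall z : 'Z_2, exists f : Ttau R, phi f = z) /\
     (forall n : nat, exists2 f : Ttau R, Ttau_val f = x_gen R n & phi f = 0) /\
     (forall n : nat, (1 <= n)%N ->
        exists2 f : Ttau R, Ttau_val f = c_gen R n & phi f = 0) /\
     (forall n : nat, exists2 f : Ttau R, Ttau_val f = y_gen R n & phi f = 1)) /\
  (exists phi : Vtau R -> 'Z_2,
     {morph phi : f g / (f * g)%g >-> f + g} /\
     (forall z : 'Z_2, exists f : Vtau R, phi f = z) /\
     (forall n : nat, phi (x_gen R n) = 0) /\
     (forall n : nat, (1 <= n)%N -> phi (c_gen R n) = 0) /\
     (forall n : nat, phi (pi_gen R n) = 0) /\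
     (forall n : nat, phi (y_gen R n) = 1)) /\
  (exists N : {pred Ttau R}, normal_of_index N 2) /\
  (exists N : {pred Vtau R}, normal_of_index N 2).
Proof.
have parity_x n : parity (x_gen R n) = 0.
  by rewrite parity_tree_elt ycarets_spine_with ycarets_spine addr0.
have parity_y n : parity (y_gen R n) = 1.
  by rewrite parity_tree_elt ycarets_spine_with ycarets_spine addr0.
have parity_c n : parity (c_gen R n) = 0.
  by rewrite parity_tree_elt !ycarets_spine addr0.
have parity_pi n : parity (pi_gen R n) = 0.
  by rewrite parity_tree_elt !ycarets_spine addr0.
have liftT f : is_Ttau f -> {g : Ttau R | Ttau_val g = f}.
  by move=> /asboolP hf; exists (MkTtau (hf : in_Ttau f)).
have surjV z : exists f : Vtau R, parity f = z.
  by case: (Z2_cases z) => ->; [exists (x_gen R 0)|exists (y_gen R 0)].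
pose parityT (f : Ttau R) := parity (Ttau_val f).
have parityTM : {morph parityT : f g / (f * g)%g >-> f + g}.
  by move=> f g; rewrite /parityT -parityM.
have surjT z : exists f : Ttau R, parityT f = z.
  have [fx hx] := liftT _ (tree_elt1_Ttau R (nleaves_spine_with xcaret 0) (nleaves_spine 2)).
  have [fy hy] := liftT _ (tree_elt1_Ttau R (nleaves_spine_with ycaret 0) (nleaves_spine 2)).
  case: (Z2_cases z) => ->; [exists fx|exists fy]; rewrite /parityT.
  - by rewrite hx parity_x.
  - by rewrite hy parity_y.
split; [|split; [|split]].
- exists parityT; do 2![split=> //]; split; [|split] => n.
  + have [f hf] := liftT _
      (tree_elt1_Ttau R (nleaves_spine_with xcaret n) (nleaves_spine n.+2)).
    by exists f; rewrite /parityT hf ?parity_x.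
  + move=> _; have [f hf] := liftT _ (c_gen_Ttau R n).
    by exists f; rewrite /parityT hf ?parity_c.
  + have [f hf] := liftT _
      (tree_elt1_Ttau R (nleaves_spine_with ycaret n) (nleaves_spine n.+2)).
    by exists f; rewrite /parityT hf ?parity_y.
- by exists (@parity R); do ![split=> //]; exact: parityM.
- by exists (fun f => parityT f == 0); exact: kernel_index2.
- by exists (fun f => parity f == 0); apply: kernel_index2 => //; exact: parityM.
Qed.
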